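(* Let $1\le i\le n-2$ and let $m$ be a positive integer. In the shifted Berenstein--Kirillov group $\mathcal{SBK}$, writing $\sigma_i=\mathsf q_i\mathsf t_1\mathsf q_i$ and $\sigma_{i+1}=\mathsf q_{i+1}\mathsf t_1\mathsf q_{i+1}$, we have $$(\sigma_i\sigma_{i+1})^m=\mathsf q_i\,\mathsf t_1\,\mathsf p_{i+1}\,\mathsf t_1\,(\mathsf t_1\mathsf t_2)^{2m}\,\mathsf t_1\,\mathsf p_{i+1}^{-1}\,\mathsf t_1\,\mathsf q_i .$$ In particular, $$(\sigma_i\sigma_{i+1})^3=\mathsf q_i\,\mathsf t_1\,\mathsf p_{i+1}\,\mathsf t_1\,(\mathsf t_1\mathsf t_2)^{6}\,\mathsf t_1\,\mathsf p_{i+1}^{-1}\,\mathsf t_1\,\mathsf q_i .$$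
   Context: **Shifted tableaux.** A strict partition $\lambda=(\lambda_1>\dots>\lambda_k>0)$ is identified with its shifted shape, the set of boxes $(r,c)$ (row $r$, column $c$, rows numbered downwards) with $1\le r\le k$, $r\le c\le r+\lambda_r-1$; boxes $(r,r)$ form the main diagonal. For strict partitions $\mu\subseteq\lambda$, $\lambda/\mu$ is the skew shifted shape obtained by removing the boxes of $\mu$ from those of $\lambda$; it is straight if $\mu=\emptyset$. Let $[n]'=\{1'<1<\dots<n'<n\}$; bold $\mathbf i$ denotes a letter that is either $i$ or $i'$. A shifted semistandard tableau of shape $\lambda/\mu$ is a filling by letters of $[n]'$, weakly increasing along rows (left to right) and columns (top to bottom), with at most one $i$ per column and at most one $i'$ per row for each $i$. The reading word is obtained by concatenating the rows from bottom to top, each read left to right. A filling is in canonical form if, for each $i$, the first letter among $i,i'$ in its reading word is unprimed; the canonical form of a filling is obtained by unpriming those first letters, and fillings with the same canonical form are identified. $\mathsf{ShST}(\lambda/\mu,n)$ is the set of shifted semistandard tableaux of shape $\lambda/\mu$ on $[n]'$ in canonical form. $T^i$ is the part of $T$ filled with $i,i'$. A tableau $B$ extends a tableau $A$ if their shapes are $\lambda/\mu$ and $\mu/\nu$ for some strict partitions $\nu\subseteq\mu\subseteq\lambda$. $A\sqcup B$ denotes the union of the two fillings. **Shifted switching process.** Let $A$ be filled with $a,a'$ and $B$ with $b,b'$, with $B$ extending $A$. In $A\sqcup B$ one performs switches (letters keep their priming unless stated otherwise; diagonal switches (S3), (S4), (S7) take precedence over the others): (S1) an $\mathbf a$-box whose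 only adjacent $\mathbf b$-box (to its right or below) is to its right is swapped with it; (S2) the same with the only adjacent $\mathbf b$-box below; (S3) $(r,r)=\mathbf a$, $(r,r+1)=b'$, $(r+1,r+1)=\mathbf b$ becomes $(r,r)=\mathbf b$, $(r,r+1)=b$, $(r+1,r+1)=\mathbf a$; (S4) $(r,r)=\mathbf a$, $(r,r+1)=a$, $(r+1,r+1)=\mathbf b$, where $\mathbf b$ is the only $\mathbf b$-box adjacent to $(r,r+1)$, becomes $(r,r)=\mathbf b$, $(r,r+1)=a'$, $(r+1,r+1)=\mathbf a$; (S5) an $\mathbf a$-box with $b'$ to its right and $\mathbf b$ below is swapped with the $b'$ to its right; (S6) an $\mathbf a$-box with unprimed $b$ to its right and $\mathbf b$ below is swapped with the $\mathbf b$ below; (S7) $(r,r)=\mathbf a$, $(r,r+1)=a$, $(r,r+2)=b$, $(r+1,r+1)=\mathbf b$ becomes $(r,r)=\mathbf b$, $(r,r+1)=a'$, $(r,r+2)=b$, $(r+1,r+1)=\mathbf a$. Repeatedly choose the rightmost unprimed $a$-box having a $\mathbf b$-box immediately to its right or below, or, if none exists, the bottommost $a'$-box with this property, and apply the applicable switch, until no $\mathbf a$-box has such a neighbour. Then $\mathsf{SP}_1(A,B)$ is the resulting $\mathbf b$-part and $\mathsf{SP}_2(A,B)$ the resulting $\mathbf a$-part. **Shifted Bender--Knuth involutions.** $\mathsf{SP}_{i,i+1}(T)$ is obtained from $T$ by replacing $T^i\sqcup T^{i+1}$ with $\mathsf{SP}_1(T^i,T^{i+1})\sqcup\mathsf{SP}_2(T^i,T^{i+1})$,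 and $\mathsf t_i(T):=\theta_i\,\mathsf{SP}_{i,i+1}(T)$, where $\theta_i$ interchanges the labels $i\leftrightarrow i+1$ and $i'\leftrightarrow (i+1)'$ (then canonicalizes). **Shifted Berenstein--Kirillov group.** $\mathcal{SBK}$ is the free group on $\mathsf t_i$, $i\ge1$, modulo all relations the operators $\mathsf t_i$ satisfy when acting on shifted semistandard tableaux of any straight shape (a word is trivial iff it acts as the identity on all such tableaux). Put $\mathsf p_i:=\mathsf t_i\mathsf t_{i-1}\cdots\mathsf t_1$ and $\mathsf q_i:=\mathsf t_1(\mathsf t_2\mathsf t_1)\cdots(\mathsf t_i\mathsf t_{i-1}\cdots\mathsf t_1)=\mathsf p_1\mathsf p_2\cdots\mathsf p_i$ for $i\ge1$. *)

(* Defs.v *)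
From HB Require Import structures.
From mathcomp Require Import all_boot.
From mathcomp Require Import finmap.
From mathcomp Require Import boolp.

Set Implicit Arguments.
Unset Strict Implicit.
Unset Printing Implicit Defensive.

Local Open Scope nat_scope.
Local Open Scope fmap_scope.

(* The letter (i, true) is i' and (i, false) is i. *)
Definition letter := (nat * bool)%type.

Definition letter_le (k l : letter) : bool :=
  (k.1 < l.1) || ((k.1 == l.1) && (l.2 ==> k.2)).

(* A box is (row, column); both coordinates are numbered from 0, so that row
   r of the shifted shape of la occupies the columns r <= c < r + la_r. *)
Definition box := (nat * nat)%type.

Definition right (x : box) : box := (x.1, x.2.+1).
Definition below (x : box) : box := (x.1.+1, x.2).
Definition diag (r : nat) : box := (r, r).

Definition strict_partition (la : seq nat) : bool :=
  sorted gtn la && (0 \notin la).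

Definition in_shape (la : seq nat) (x : box) : bool :=
  x.1 <= x.2 < x.1 + nth 0 la x.1.

Definition filling := {fmap box -> letter}.

Implicit Types T A B : filling.

Definition has_value (v : nat) T (x : box) : bool :=
  if T.[? x] is Some l then l.1 == v else false.

Definition has_prime T (x : box) : bool :=
  if T.[? x] is Some l then l.2 else false.

Definition part (v : nat) T : filling := filterf T (has_value v T).

(* Order of the boxes in the reading word. *)
Definition reading_lt (x y : box) : bool :=
  (y.1 < x.1) || ((x.1 == y.1) && (x.2 < y.2)).

(* x carries the first letter among i, i' in the reading word of T, where
   i is the value of its letter. *)
Definition first_in_reading T (x : domf T) : bool :=
  [forall y : domf T, ((T y).1 == (T x).1) ==> ~~ reading_lt (val y) (val x)].

Definition canonical T : bool :=
  [forall x : domf T, first_in_reading x ==> ~~ (T x).2].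

Definition canonize T : filling :=
  [fmap x : domf T => ((T x).1, (T x).2 && ~~ first_in_reading x)].

Record ShST (la mu : seq nat) (n : nat) T : Prop := {
  ShST_la : strict_partition la;
  ShST_mu : strict_partition mu;
  ShST_sub : forall x, in_shape mu x -> in_shape la x;
  ShST_dom : forall x, (x \in domf T) = in_shape la x && ~~ in_shape mu x;
  ShST_alphabet : forall x l, T.[? x] = Some l -> 1 <= l.1 <= n;
  ShST_row : forall r c c' k l, c <= c' ->
    T.[? (r, c)] = Some k -> T.[? (r, c')] = Some l -> letter_le k l;
  ShST_col : forall r r' c k l, r <= r' ->
    T.[? (r, c)] = Some k -> T.[? (r', c)] = Some l -> letter_le k l;
  ShST_unprimed : forall r r' c i,
    T.[? (r, c)] = Some (i, false) -> T.[? (r', c)] = Some (i, false) -> r = r';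
  ShST_primed : forall r c c' i,
    T.[? (r, c)] = Some (i, true) -> T.[? (r, c')] = Some (i, true) -> c = c';
  ShST_canonical : canonical T
}.

Definition straight_tableau T : Prop := exists la n, ShST la [::] n T.

Section Switching.

Variables a b : nat.

Definition switchable T (x : box) : bool :=
  has_value a T x && (has_value b T (right x) || has_value b T (below x)).

(* The box treated by the next switch: the rightmost switchable a or, if there
   is none, the bottommost switchable a'.  Along the process the a-part keeps
   at most one a per column and one a' per row, so there are no ties. *)
Definition next_box T : option box :=
  let cand p := [pred x : domf T |
    switchable T (val x) && (has_prime T (val x) == p)] in
  if [pick x | cand false x &&
        [forall y, cand false y ==> ((val y).2 <= (val x).2)]] is Some x
  then Some (val x)
  else if [pick x | cand true x &&
             [forall y, cand true y ==> ((val y).1 <= (val x).1)]] is Some x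
  then Some (val x)
  else None.

Definition swap T (x y : box) : filling :=
  if (T.[? x], T.[? y]) is (Some k, Some l) then T.[x <- l].[y <- k] else T.

Definition switch T (x : box) : filling :=
  let r := x.1 in
  let b_right := has_value b T (right x) in
  let b_below := has_value b T (below x) in
  if [&& x == diag r, T.[? right x] == Some (b, true)
       & has_value b T (diag r.+1)]
  then (* S3 *) (swap T x (diag r.+1)).[right x <- (b, false)]
  else if [&& x == right (diag r), has_value a T (diag r),
              T.[? x] == Some (a, false), b_below
            & ~~ b_right || (T.[? right x] == Some (b, false))]
  then (* S4 if ~~ b_right, S7 otherwise *)
    (swap T (diag r) (diag r.+1)).[x <- (a, true)]
  else if b_right && ~~ b_below then (* S1 *) swap T x (right x)
  else if b_below && ~~ b_right then (* S2 *) swap T x (below x)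
  else if has_prime T (right x) then (* S5 *) swap T x (right x)
  else (* S6 *) swap T x (below x).

Definition switch_step T : filling :=
  if next_box T is Some x then switch T x else T.

(* Each switch increases the sum of r + c over the boxes (r, c) containing a or
   a', so this number of steps reaches the state where no switch applies. *)
Definition switching T : filling :=
  iter (\sum_(x : domf T) ((val x).1 + (val x).2)) switch_step T.

Definition SP1 A B : filling := part b (switching (A + B)%fset).
Definition SP2 A B : filling := part a (switching (A + B)%fset).

End Switching.

Definition SP (i : nat) T : filling :=
  (T + (SP1 i i.+1 (part i T) (part i.+1 T)
        + SP2 i i.+1 (part i T) (part i.+1 T)))%fset.

Definition theta (i : nat) T : filling :=
  canonize [fmap x : domf T =>
    ([eta id with i |-> i.+1, i.+1 |-> i] (T x).1, (T x).2)].

Definition BK (i : nat) T : filling := theta i (SP i T).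

(* Words in the generators t_i and their inverses: (k, false) stands for
   t_(k.+1) and (k, true) for its inverse. *)
Definition gen := (nat * bool)%type.
Definition word := seq gen.

Definition inv_gen (g : gen) : gen := (g.1, ~~ g.2).
Definition inv_word (w : word) : word := rev (map inv_gen w).

(* acts w T T' : the word w, its rightmost letter being applied first, sends T
   to T'.  An inverse letter acts by the converse of the graph of t_i. *)
Fixpoint acts (w : word) T T' : Prop :=
  if w is (k, e) :: w1 then
    exists T1, [/\ straight_tableau T1, acts w1 T T1
      & if e then T1 = BK k.+1 T' else T' = BK k.+1 T1]
  else T = T'.

Definition acts_trivially (w : word) : Prop :=
  forall T T', straight_tableau T -> straight_tableau T' ->
    (acts w T T' <-> T = T').

(* Equality in the quotient of the free group on the t_i by the normal closure
   of the words acting trivially; see sbk_eq_trivial. *)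
Inductive sbk_eq : word -> word -> Prop :=
| sbk_refl w : sbk_eq w w
| sbk_sym u v : sbk_eq u v -> sbk_eq v u
| sbk_trans u v w : sbk_eq u v -> sbk_eq v w -> sbk_eq u w
| sbk_cat u u' v v' : sbk_eq u u' -> sbk_eq v v' -> sbk_eq (u ++ v) (u' ++ v')
| sbk_cancel g : sbk_eq [:: g; inv_gen g] [::]
| sbk_trivial w : acts_trivially w -> sbk_eq w [::].

Lemma acts_cat u v T T' : straight_tableau T -> straight_tableau T' ->
  acts (u ++ v) T T' <->
  exists T1, [/\ straight_tableau T1, acts v T T1 & acts u T1 T'].
Proof.
move=> hT; elim: u T' => [|[k e] u IH] T' hT' /=.
  by split=> [h|[T1 [_ h <-]]] //; exists T'.
split=> [[T1 [h1 /(IH _ h1) [T2 [h2 h3 h4]] h5]]|[T1 [h1 h2 [T2 [h3 h4 h5]]]]].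
  by exists T2; split=> //; exists T1.
by exists T2; split=> //; apply/IH => //; exists T1.
Qed.

(* As soon as the t_i are permutations of the straight-shape tableaux, passing
   to the normal closure adds nothing: a word is trivial iff it acts as the
   identity. *)
Lemma sbk_eq_trivial :
  (forall i T, 0 < i -> straight_tableau T -> straight_tableau (BK i T)) ->
  (forall i T', 0 < i -> straight_tableau T' ->
     exists! T, straight_tableau T /\ BK i T = T') ->
  forall w, sbk_eq w [::] <-> acts_trivially w.
Proof.
move=> BKs BKb w; split; last exact: sbk_trivial.
suff H u v : sbk_eq u v -> forall T T', straight_tableau T ->
    straight_tableau T' -> (acts u T T' <-> acts v T T') by move/H.
elim=> {u v} //.
- by move=> u v _ IH T T' hT hT'; rewrite (IH T T').
- by move=> u v x _ IH1 _ IH2 T T' hT hT'; rewrite (IH1 T T') ?(IH2 T T').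
- move=> u u' v v' _ IH1 _ IH2 T T' hT hT'; rewrite !acts_cat //.
  by split=> -[T1 [h1 h2 h3]]; exists T1; split=> //; apply/IH1 || apply/IH2.
move=> [k e] T T' hT hT' /=; split.
  move=> [T1 [h1 [T2 [h2 <-]]]]; case: e => /= [->|-> ->] //.
  move=> e2; have [T3 [_ U]] := BKb k.+1 (BK k.+1 T) (ltn0Sn k) (BKs _ _ (ltn0Sn k) hT).
  by rewrite -(U T) // -(U T') // -e2.
move=> <-; case: e => /=.
  by exists (BK k.+1 T); split=> //; [exact: BKs | exists T].
have [T1 [[h1 h2] _]] := BKb k.+1 T (ltn0Sn k) hT.
by exists T1; split=> //; exists T.
Qed.

Lemma sbk_cancel_word w : sbk_eq (w ++ inv_word w) [::].
Proof.
elim: w => [|g w IH]; first exact: sbk_refl.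
have -> : inv_word (g :: w) = inv_word w ++ [:: inv_gen g].
  by rewrite /inv_word /= rev_cons cats1.
rewrite -cat1s -catA (catA w).
apply: sbk_trans (sbk_cancel g).
apply: (sbk_cat (sbk_refl [:: g]) (sbk_cat IH (sbk_refl [:: inv_gen g]))).
Qed.

Lemma inv_wordK : involutive inv_word.
Proof.
move=> w; rewrite /inv_word map_rev revK -map_comp -[RHS]map_id.
by apply: eq_map => -[k e]; rewrite /inv_gen /= negbK.
Qed.

Lemma sbk_cancel_wordV w : sbk_eq (inv_word w ++ w) [::].
Proof. by have := sbk_cancel_word (inv_word w); rewrite inv_wordK. Qed.

Lemma sbk_inv u v : sbk_eq u v -> sbk_eq (inv_word u) (inv_word v).
Proof.
move=> h; have r := sbk_refl.
apply: (@sbk_trans _ ((inv_word v ++ v) ++ inv_word u)).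
  by apply: sbk_sym; apply: sbk_cat (sbk_cancel_wordV v) (r _).
rewrite -catA -[X in sbk_eq _ X]cats0; apply: sbk_cat (r _) _.
exact: sbk_trans (sbk_cat (sbk_sym h) (r _)) (sbk_cancel_word u).
Qed.

Local Open Scope quotient_scope.

Definition sbk_rel : rel word := fun u v => `[< sbk_eq u v >].

Lemma sbk_rel_refl : reflexive sbk_rel.
Proof. by move=> w; apply/asboolP; apply: sbk_refl. Qed.

Lemma sbk_rel_sym : symmetric sbk_rel.
Proof. by move=> u v; apply/asboolP/asboolP => /sbk_sym. Qed.

Lemma sbk_rel_trans : transitive sbk_rel.
Proof.
by move=> v u w /asboolP h /asboolP h'; apply/asboolP; apply: sbk_trans h h'.
Qed.

Canonical sbk_equiv := EquivRel sbk_rel sbk_rel_refl sbk_rel_sym sbk_rel_trans.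

Definition SBK := {eq_quot sbk_equiv}.
HB.instance Definition _ := EqQuotient.on SBK.
HB.instance Definition _ := Choice.on SBK.

Definition sbk_class (w : word) : SBK := \pi_SBK w.

Lemma sbk_classP u v : sbk_class u = sbk_class v <-> sbk_eq u v.
Proof. by split=> [/eqmodP/asboolP|h] //; apply/eqmodP/asboolP. Qed.

Lemma sbk_reprK x : sbk_class (repr x) = x.
Proof. exact: reprK. Qed.

Definition SBK_one : SBK := sbk_class [::].
Definition SBK_mul (x y : SBK) : SBK := sbk_class (repr x ++ repr y).
Definition SBK_inv (x : SBK) : SBK := sbk_class (inv_word (repr x)).

Lemma SBK_mulE u v : SBK_mul (sbk_class u) (sbk_class v) = sbk_class (u ++ v).
Proof. by apply/sbk_classP/sbk_cat; apply/sbk_classP; rewrite sbk_reprK. Qed.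

Lemma SBK_invE u : SBK_inv (sbk_class u) = sbk_class (inv_word u).
Proof. by apply/sbk_classP/sbk_inv; apply/sbk_classP; rewrite sbk_reprK. Qed.

Lemma SBK_mulA : associative SBK_mul.
Proof.
by move=> x y z; rewrite -[x]sbk_reprK -[y]sbk_reprK -[z]sbk_reprK !SBK_mulE catA.
Qed.

Lemma SBK_mul1 : left_id SBK_one SBK_mul.
Proof. by move=> x; rewrite -[x]sbk_reprK SBK_mulE. Qed.

Lemma SBK_mulr1 : right_id SBK_one SBK_mul.
Proof. by move=> x; rewrite -[x]sbk_reprK SBK_mulE cats0. Qed.

Lemma SBK_mulV : left_inverse SBK_one SBK_inv SBK_mul.
Proof.
move=> x; rewrite -[x]sbk_reprK SBK_invE SBK_mulE.
exact/sbk_classP/sbk_cancel_wordV.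
Qed.

Lemma SBK_mulrV : right_inverse SBK_one SBK_inv SBK_mul.
Proof.
move=> x; rewrite -[x]sbk_reprK SBK_invE SBK_mulE.
exact/sbk_classP/sbk_cancel_word.
Qed.

HB.instance Definition _ := isGroup.Build SBK
  SBK_mulA SBK_mul1 SBK_mulr1 SBK_mulV SBK_mulrV.

Local Open Scope group_scope.

(* The generator t_i; meaningful for 1 <= i only (i = 0 gives t_1 again). *)
Definition t_ (i : nat) : SBK := sbk_class [:: (i.-1, false)].

(* p_ i = t_i t_(i-1) ... t_1 and q_ i = p_1 p_2 ... p_i. *)
Fixpoint p_ (i : nat) : SBK := if i is j.+1 then t_ i * p_ j else 1.
Fixpoint q_ (i : nat) : SBK := if i is j.+1 then q_ j * p_ i else 1.

Definition sigma (i : nat) : SBK := q_ i * t_ 1 * q_ i.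

(* Main.v *)
From HB Require Import structures.
Require Import Defs.
From mathcomp Require Import all_boot finmap zify.

Set Implicit Arguments.
Unset Strict Implicit.
Unset Printing Implicit Defensive.

(** The identity follows from two kinds of relations of the group alone: every
t_i is an involution, and t_i, t_j commute as soon as |i - j| > 1.  They give
q_k p_(k+1) = p_(k+1)^-1 q_k, hence q_k^2 = 1 ([twist_flip], [twist_sq]), and
p_(i+1)^-1 t_1 p_(i+1) = t_1 t_2 t_1 t_2 t_1 ([run_conj]), because in
t_(i+1) ... t_3 t_2 t_1 all the factors t_(i+1), ..., t_3 commute with t_1.
It follows that sigma_i sigma_(i+1) is the conjugate of (t_1 t_2)^2 by
q_i t_1 p_(i+1) t_1 ([twist_product]), and powers of a conjugate are conjugates
of powers.

The substance of the proof is therefore that t_i permutes the tableaux of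
straight shape and is an involution there ([BK_straight], [BK_involutive]).
Commutation is then clear, since t_i reads and rewrites only the letters of
values i and i + 1 ([BK_commute]).

To see that t_i is an involution, one standardizes.  The boxes with letters v
and v' are listed as follows: first the primed ones from top to bottom, then
the unprimed ones from left to right.  Adding them in this order to the boxes
with smaller letters, one runs through order ideals (a [chain]); along the list
the rows increase strictly up to some point, and from there on the columns do (a
[valley]).  The canonical form puts the turning point at the first unprimed
letter, so that the primed letters are exactly those followed by a descent, and
the list determines the filling.  Conversely tableaux are the
fillings for which every value has such a list ([ShST_standardizes],
[standardizes_ShST]).

Let a_0, a_1, ... and b_0, b_1, ... be the lists for the values i and i + 1.
Moving one a past one b exchanges their positions if the b stands immediately
to the right of the a or below it, and otherwise changes nothing.  Doing this
for all pairs fills a rectangle, the [growth] diagram of Fomin: its cells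
record how the order ideals change when a_i and b_j are added in one or the other
order.  The local rule is symmetric under transposition ([growth_tr]), and
transposition exchanges the roles of the two letters.  Hence switching twice
gives back the original lists, provided that switching computes the diagram.

That it does so is the other half.  All rows and columns of the diagram are
valleys ([level_a_step], [level_b_step]).  The number of descents can change
only at a corner on the main diagonal: these are the patterns in which
(S3), (S4) and (S7) alter the priming.  A state of the switching process is
described by a monotone lattice path in the diagram.  Because the lists are
valleys, the box selected by the process is the last a which still has a b as
neighbour, and the rules (S5) and (S6) select the first b which it has to pass;
so every switch moves the path across cells of the diagram ([step_good]), until
all the a have passed all the b ([switching_growth]). *)

Local Open Scope nat_scope.
Local Open Scope fmap_scope.

Implicit Types T : filling.

(** * Order ideals, chains and valleys *)

Definition adj (x y : box) : bool := (y == right x) || (y == below x).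

(** The order is the componentwise order on the boxes on or above the main
diagonal. *)
Definition ideal (S : pred box) : Prop :=
  (forall r c, S (r, c) -> r <= c) /\
  (forall r c r' c', S (r', c') -> r <= r' -> c <= c' -> r <= c -> S (r, c)).

Lemma box_eqE (x y : box) : (x == y) = (x.1 == y.1) && (x.2 == y.2).
Proof. by case: x y => r c [r' c']. Qed.

Lemma adjE (r c r' c' : nat) :
  adj (r, c) (r', c') =
    ((r' == r) && (c' == c.+1)) || ((r' == r.+1) && (c' == c)).
Proof. by []. Qed.

(** The boxes x 0, ..., x (p - 1) form a standard filling of the difference of
the ideals S p and S 0. *)
Record chain (p : nat) (S : nat -> pred box) (x : nat -> box) : Prop := {
  chain_ideal : forall i, i <= p -> ideal (S i);
  chain_step : forall i, i < p -> forall z, S i.+1 z = (z == x i) || S i z;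
  chain_new : forall i, i < p -> ~~ S i (x i)
}.

Section Chain.

Variables (p : nat) (S : nat -> pred box) (x : nat -> box).
Hypothesis xP : chain p S x.

Lemma chain_sub i j z : i <= j -> j <= p -> S i z -> S j z.
Proof.
elim: j => [|j IH]; first by rewrite leqn0 => /eqP->.
rewrite leq_eqVlt ltnS => /orP[/eqP->//|le_ij lt_jp Siz].
by rewrite (chain_step xP) // IH ?orbT // ltnW.
Qed.

Lemma chain_mem i j : i < j -> j <= p -> S j (x i).
Proof.
move=> lt_ij le_jp; apply: (chain_sub lt_ij le_jp).
by rewrite (chain_step xP) ?eqxx //; lia.
Qed.

Lemma chain_inv i j z : i <= j -> j <= p -> S j z ->
  S i z \/ exists m, [/\ i <= m, m < j & z = x m].
Proof.
elim: j => [|j IH]; first by rewrite leqn0 => /eqP-> _; left.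
rewrite leq_eqVlt ltnS => /orP[/eqP-> _|le_ij lt_jp]; first by left.
rewrite (chain_step xP) // => /orP[/eqP->|/(IH le_ij (ltnW lt_jp))].
  by right; exists j.
case=> [?|[m [? ? ?]]]; [by left|right; exists m; split=> //; lia].
Qed.

Lemma chain_quad i : i < p -> (x i).1 <= (x i).2.
Proof.
move=> lt_ip; have := chain_mem (ltnSn i) lt_ip.
by case: (x i) => r c; exact: (chain_ideal xP lt_ip).1.
Qed.

Lemma chain_le i j : i < j -> j < p ->
  (x j).1 <= (x i).1 -> (x j).2 <= (x i).2 -> False.
Proof.
move=> lt_ij lt_jp le1 le2; have := chain_new xP lt_jp.
have := chain_mem lt_ij (ltnW lt_jp); have := chain_quad lt_jp.
case: (x i) (x j) le1 le2 => r c [r' c'] /= le1 le2 le3 Si /negP[].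
exact: (chain_ideal xP (ltnW lt_jp)).2 Si le1 le2 le3.
Qed.

Lemma chain_mid i j r c : i < j -> j < p ->
  (x i).1 <= r -> r <= (x j).1 -> (x i).2 <= c -> c <= (x j).2 ->
  r <= c -> exists m, [/\ i <= m, m <= j & x m = (r, c)].
Proof.
move=> lt_ij lt_jp le1 le2 le3 le4 le5.
have Sj : S j.+1 (r, c).
  have := chain_mem (ltnSn j) lt_jp; case: (x j) le2 le4 => r' c' /= le2 le4 Sj.
  exact: (chain_ideal xP lt_jp).2 Sj le2 le4 le5.
have [Si|[m [? ? ?]]] := chain_inv (leqW (ltnW lt_ij)) lt_jp Sj; last by exists m.
have lt_ip : i < p by lia.
have /negP[] := chain_new xP lt_ip; have := chain_quad lt_ip.
case: (x i) le1 le3 => r' c' /= le1 le3 le6.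
exact: (chain_ideal xP (ltnW lt_ip)).2 Si le1 le3 le6.
Qed.

Lemma chain_inj i j : i < p -> j < p -> x i = x j -> i = j.
Proof.
move=> lt_ip lt_jp eq_x.
by case: (ltngtP i j) => // lt; exfalso;
  [apply: (chain_le lt) => //; rewrite eq_x | apply: (chain_le lt); rewrite ?eq_x].
Qed.

End Chain.

(** The length of the initial run of descents, a descent being a step to a
strictly lower row. *)
Definition descents (p : nat) (x : nat -> box) : nat :=
  find (fun i => (x i.+1).1 <= (x i).1) (iota 0 p.-1).

Definition valley (p : nat) (x : nat -> box) : Prop :=
  forall i, descents p x <= i -> i.+1 < p -> (x i).2 < (x i.+1).2.

Lemma descents_le p x : descents p x <= p.-1.
Proof. by rewrite -[X in _ <= X](size_iota 0 p.-1) find_size. Qed.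

Lemma descents_lt p x i : i < descents p x -> (x i).1 < (x i.+1).1.
Proof.
move=> lt_ik; have := before_find 0 lt_ik.
rewrite nth_iota ?add0n; first by rewrite leqNgt => /negbFE.
exact: leq_trans lt_ik (descents_le _ _).
Qed.

Section Valley.

Variables (p : nat) (S : nat -> pred box) (x : nat -> box).
Hypothesis xP : chain p S x.
Hypothesis xV : valley p x.
Let k := descents p x.

Lemma valley_row i j : i < j -> j <= k -> (x i).1 < (x j).1.
Proof.
elim: j => // j IH; rewrite ltnS leq_eqVlt => /orP[/eqP->|lt_ij] le_jk.
  exact: descents_lt le_jk.
exact: ltn_trans (IH lt_ij (ltnW le_jk)) (descents_lt le_jk).
Qed.

Lemma valley_col i j : k <= i -> i < j -> j < p -> (x i).2 < (x j).2.
Proof.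
elim: j => // j IH; rewrite ltnS => le_ki; rewrite leq_eqVlt => /orP[/eqP<-|lt_ij] lt_jp.
  exact: xV.
by apply: ltn_trans (IH le_ki lt_ij (ltnW lt_jp)) (xV _ lt_jp); lia.
Qed.

(** The box in the row of x i and the column of x j would lie in the chain
between them: it has the row of x i, hence comes after the descents, and the
column of x j, hence comes before their end. *)
Lemma valley_noSE i j : i < p -> j < p -> (x i).1 < (x j).1 ->
  (x i).2 < (x j).2 -> False.
Proof.
move=> lt_ip lt_jp lt1 lt2.
have lt_ij : i < j.
  rewrite ltnNge leq_eqVlt; apply/negP => /orP[/eqP eq_ij|lt_ji].
    by move: lt1; rewrite eq_ij ltnn.
  by apply: (chain_le xP lt_ji) => //; exact: ltnW.
have := chain_quad xP lt_ip => le3.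
have [m [le_im le_mj eq_m]] : exists m, [/\ i <= m, m <= j & x m = ((x i).1, (x j).2)].
  by apply: (chain_mid xP lt_ij lt_jp); lia.
have nim : i != m by apply/eqP => eq_im; move: lt2; rewrite eq_im eq_m ltnn.
have njm : m != j by apply/eqP => eq_jm; move: lt1; rewrite -eq_jm eq_m ltnn.
have [le_mk|lt_km] := leqP m k.
  by have := @valley_row i m; rewrite eq_m /=; lia.
by have := @valley_col m j; rewrite eq_m /=; lia.
Qed.

(** The box at the turning point of a valley comes in a strictly lower row than
the boxes before it, and in a column strictly further left than the boxes after
it; so another box on the diagonal would be strictly north-west or south-east of
it, against [valley_noSE].  This lemma is what keeps track of the priming: it forces diagonal boxes
to be unprimed, and it locates the index at which the number of descents changes. *)
Lemma valley_diag i : i < p -> (x i).1 = (x i).2 -> i = k.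
Proof.
move=> lt_ip eq_i; case: (ltngtP i k) => // lt; exfalso.
  have lt_kp : k < p by have := descents_le p x; rewrite -/k; lia.
  have := chain_quad xP lt_kp; have := valley_row lt (leqnn k) => lt1 le1.
  by apply: (@valley_noSE i k) => //; lia.
have lt_kp : k < p by lia.
have lt1 := valley_col (leqnn k) lt lt_ip; have le1 := chain_quad xP lt_kp.
by apply: (@valley_noSE k i) => //; lia.
Qed.

(** A step cannot be both a descent and a step to a strictly larger column, so
the turning point is unique. *)
Lemma valley_descents k' : k' <= p.-1 ->
  (forall i, i < k' -> (x i).1 < (x i.+1).1) ->
  (forall i, k' <= i -> i.+1 < p -> (x i).2 < (x i.+1).2) -> k' = k.
Proof.
move=> le_k' row_k' col_k'; case: (ltngtP k' k) => // lt; exfalso.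
  have := descents_lt lt; have := col_k' k' (leqnn _) => lt2 lt1.
  have := descents_le p x; rewrite -/k => le_k.
  by apply: (@valley_noSE k' k'.+1) => //; [lia..|apply: lt2; lia].
have := row_k' k lt; have := @xV k (leqnn _) => lt2 lt1.
by apply: (@valley_noSE k k.+1) => //; [lia..|apply: lt2; lia].
Qed.

End Valley.

Lemma valley_intro p S x k : chain p S x -> k <= p.-1 ->
  (forall i, i < k -> (x i).1 < (x i.+1).1) ->
  (forall i, k <= i -> i.+1 < p -> (x i).2 < (x i.+1).2) ->
  valley p x /\ descents p x = k.
Proof.
move=> xP le_k row_k col_k.
suff xV : valley p x by split=> //; rewrite (valley_descents xP xV le_k row_k col_k).
move=> i le_i lt_ip; apply: col_k => //; rewrite leqNgt; apply/negP => lt_ik.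
have lt_i : descents p x < k by lia.
suff : (x (descents p x).+1).1 <= (x (descents p x)).1.
  by have := row_k _ lt_i; lia.
have hs : has (fun i => (x i.+1).1 <= (x i).1) (iota 0 p.-1).
  by rewrite has_find size_iota; have := le_k; rewrite /descents in lt_i *; lia.
have := nth_find 0 hs; rewrite nth_iota ?add0n //.
by move: hs; rewrite has_find size_iota.
Qed.

(** * Sliding a box past two consecutive boxes *)

(** Here x is the box of an inner letter and y the box of the outer letter which
it meets; y' and x' are their boxes after the exchange. *)
Definition cell (x y y' x' : box) : Prop :=
  if adj x y then y' = x /\ x' = y else y' = y /\ x' = x.

Definition triple (x y z : box) (s : nat) : box := nth z [:: x; y] s.

(** Convexity of a difference of ideals, in the shape used below: the corner
boxes in question have to be among the three boxes. *)
Lemma triple_mid S x y z r c : chain 3 S (triple x y z) ->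
  x.1 <= r -> x.2 <= c -> r <= c ->
  (r <= y.1) && (c <= y.2) || (r <= z.1) && (c <= z.2) ->
  [\/ x = (r, c), y = (r, c) | z = (r, c)].
Proof.
move=> ch le1 le2 le3 /orP[]/andP[le4 le5].
  have [//|//|//|//|//|//|//|[|[|[|m]]] [_ _ /= <-]] := @chain_mid _ _ _ ch 0 1 r c;
    by [constructor 1|constructor 2|constructor 3].
have [//|//|//|//|//|//|//|[|[|[|m]]] [_ _ /= <-]] := @chain_mid _ _ _ ch 0 2 r c;
  by [constructor 1|constructor 2|constructor 3].
Qed.

Lemma triple_mid2 S x y z r c : chain 3 S (triple x y z) ->
  y.1 <= r -> y.2 <= c -> r <= c -> r <= z.1 -> c <= z.2 ->
  y = (r, c) \/ z = (r, c).
Proof.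
move=> ch le1 le2 le3 le4 le5.
by have [//|//|//|//|//|//|//|[|[|[|m]]] [? ? /= <-]] := @chain_mid _ _ _ ch 1 2 r c; auto.
Qed.

Lemma triple_order S x y z : chain 3 S (triple x y z) ->
  [/\ [/\ x.1 <= x.2, y.1 <= y.2 & z.1 <= z.2],
      ~~ ((y.1 <= x.1) && (y.2 <= x.2)),
      ~~ ((z.1 <= x.1) && (z.2 <= x.2)) &
      ~~ ((z.1 <= y.1) && (z.2 <= y.2))].
Proof.
move=> ch; split; first split.
- exact: (chain_quad ch (isT : 0 < 3)).
- exact: (chain_quad ch (isT : 1 < 3)).
- exact: (chain_quad ch (isT : 2 < 3)).
- by apply/negP => /andP[]; exact: (@chain_le _ _ _ ch 0 1).
- by apply/negP => /andP[]; exact: (@chain_le _ _ _ ch 0 2).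
- by apply/negP => /andP[]; exact: (@chain_le _ _ _ ch 1 2).
Qed.

(* y2 slides inward through x1, then x0 *)
Section Inward.
Variables (S : nat -> pred box) (x0 x1 y2 y1 y0 x0' x1' : box).
Hypothesis ch : chain 3 S (triple x0 x1 y2).
Hypothesis cell1 : cell x1 y2 y1 x1'.
Hypothesis cell0 : cell x0 y1 y0 x0'.

(** If x0 moved down into the row of x1', then convexity would put a fourth box
between x0 and the boxes after it. *)
Lemma inward_row : x0.1 < x1.1 -> x0'.1 < x1'.1.
Proof.
have [[q0 q1 q2] o1 o2 o3] := triple_order ch.
have M0 := @triple_mid _ _ _ _ x0.1 x0.2.+1 ch.
have M1 := @triple_mid2 _ _ _ _ y2.1 y2.2.-1 ch.
move: cell1 cell0; rewrite /cell.
case: x0 x1 y2 q0 q1 q2 o1 o2 o3 M0 M1 => r0 c0 [r1 c1] [r2 c2] /= q0 q1 q2 o1 o2 o3 M0 M1.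
case: ifP; rewrite adjE => a1 [-> ->]; case: ifP; rewrite adjE => a0 [_ ->] /=; try lia.
- move=> lt; case/orP: a0 => /andP[/eqP e1 /eqP e2]; case/orP: a1 => /andP[/eqP e3 /eqP e4]; try lia.
  by case: M0; try lia; case; lia.
- move=> lt; case/orP: a0 => /andP[/eqP e1 /eqP e2]; try lia.
  case: (ltnP r2 r1) => [//|le]; case: (ltnP c1 c2) => [lt12|]; last by lia.
  by case: M1; try lia; case; lia.
Qed.

(** The same argument as for rows with the coordinates exchanged, except that the
fourth box can be missing because it would lie below the main diagonal.  This is
the configuration of (S4) and (S7). *)
Lemma inward_col : x0.2 < x1.2 -> x0'.2 < x1'.2 \/
  exists r, [/\ x0 = (r, r), x1 = (r, r.+1) & y2 = (r.+1, r.+1)].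
Proof.
have [[q0 q1 q2] o1 o2 o3] := triple_order ch.
have M0 := @triple_mid _ _ _ _ x0.1.+1 x0.2 ch.
have M1 := @triple_mid2 _ _ _ _ y2.1.-1 y2.2 ch.
move: cell1 cell0; rewrite /cell.
case: x0 x1 y2 q0 q1 q2 o1 o2 o3 M0 M1 => r0 c0 [r1 c1] [r2 c2] /= q0 q1 q2 o1 o2 o3 M0 M1.
case: ifP; rewrite adjE => a1 [-> ->]; case: ifP; rewrite adjE => a0 [_ ->] /= lt;
  try by left; lia.
- case/orP: a0 => /andP[/eqP e1 /eqP e2]; case/orP: a1 => /andP[/eqP e3 /eqP e4]; try by left; lia.
  case: (ltngtP r0 c0) => [lt0||e0]; [|lia|].
    by exfalso; case: M0; try lia; case; lia.
  by right; exists r0; split; congr pair; lia.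
- left; case/orP: a0 => /andP[/eqP e1 /eqP e2]; try lia.
  case: (ltnP c2 c1) => [//|le]; case: (ltnP r1 r2) => [lt12|]; last by lia.
  by case: M1; try lia; case; lia.
Qed.

End Inward.

(* h0 slides outward through y0, then y1 *)
Section Outward.
Variables (S : nat -> pred box) (h0 y0 y1 h1 h2 y0' y1' : box).
Hypothesis ch : chain 3 S (triple h0 y0 y1).
Hypothesis cell0 : cell h0 y0 y0' h1.
Hypothesis cell1 : cell h1 y1 y1' h2.

(** The dual of [inward_row]. *)
Lemma outward_col : y0.2 < y1.2 -> y0'.2 < y1'.2.
Proof.
have [[q0 q1 q2] o1 o2 o3] := triple_order ch.
have M0 := @triple_mid _ _ _ _ h0.1 h0.2.+1 ch.
have M1 := @triple_mid _ _ _ _ h0.1.+1 h0.2 ch.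
move: cell0 cell1; rewrite /cell.
case: h0 y0 y1 q0 q1 q2 o1 o2 o3 M0 M1 => r0 c0 [r1 c1] [r2 c2] /= q0 q1 q2 o1 o2 o3 M0 M1.
case: ifP; rewrite adjE => a0 [-> ->]; case: ifP; rewrite adjE => a1 [-> _] /= lt; try lia.
- case/orP: a0 => /andP[/eqP e1 /eqP e2]; case/orP: a1 => /andP[/eqP e3 /eqP e4]; try lia.
  by case: M0; try lia; case; lia.
- case/orP: a1 => /andP[/eqP e3 /eqP e4]; try lia.
  case: (ltnP c1 c0) => // le; have e : c1 = c0 by lia.
  by case: M1; try lia; case; lia.
Qed.

(** The dual of [inward_col]; the exceptional configuration is that of (S3). *)
Lemma outward_row : y0.1 < y1.1 -> y0'.1 < y1'.1 \/
  exists r, [/\ h0 = (r, r), y0 = (r, r.+1) & y1 = (r.+1, r.+1)].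
Proof.
have [[q0 q1 q2] o1 o2 o3] := triple_order ch.
have M0 := @triple_mid _ _ _ _ h0.1 h0.2.+1 ch.
have M1 := @triple_mid _ _ _ _ h0.1.+1 h0.2 ch.
move: cell0 cell1; rewrite /cell.
case: h0 y0 y1 q0 q1 q2 o1 o2 o3 M0 M1 => r0 c0 [r1 c1] [r2 c2] /= q0 q1 q2 o1 o2 o3 M0 M1.
case: ifP; rewrite adjE => a0 [-> ->]; case: ifP; rewrite adjE => a1 [-> _] /= lt;
  try by left; lia.
- case/orP: a0 => /andP[/eqP e1 /eqP e2]; case/orP: a1 => /andP[/eqP e3 /eqP e4]; try by left; lia.
  case: (ltngtP r0 c0) => [lt0||e0]; [|lia|].
    by exfalso; case: M1; try lia; case; lia.
  by right; exists r0; split; congr pair; lia.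
- left; case/orP: a1 => /andP[/eqP e3 /eqP e4]; try lia.
  case: (ltnP r1 r0) => // le; have e : r1 = r0 by lia.
  by case: M0; try lia; case; lia.
Qed.

End Outward.

(** * Growth diagrams *)

(** For the ideals S i j, the letter a_i has the box ga i j after j of the letters b
have been added before it, and b_j has the box gb i j after i of the letters a.
The first list is thus ga^~ 0 and the last one gb p; switching leads from
the path (ga^~ 0, gb p) to the path (gb 0, ga^~ q). *)
Record growth (p q : nat) (S : nat -> nat -> pred box)
    (ga gb : nat -> nat -> box) : Prop := {
  growth_a : forall j, j <= q -> chain p (S^~ j) (ga^~ j);
  growth_b : forall i, i <= p -> chain q (S i) (gb i);
  growth_cell : forall i j, i < p -> j < q ->
    cell (ga i j) (gb i.+1 j) (gb i j) (ga i j.+1)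
}.

Lemma growth_sub p q S ga gb i j i' j' z : growth p q S ga gb ->
  i <= i' -> i' <= p -> j <= j' -> j' <= q -> S i j z -> S i' j' z.
Proof.
move=> G le_i le_ip le_j le_jq Sz.
apply: (chain_sub (growth_b G le_ip) le_j le_jq).
by apply: (chain_sub (growth_a G _) le_i le_ip); rewrite // (leq_trans le_j).
Qed.

(** The local rule only says that S i.+1 j and S i j.+1 differ whenever two ideals
between S i j and S i.+1 j.+1 exist, a condition in which the two directions play
the same role. *)
Lemma growth_tr p q S ga gb : growth p q S ga gb ->
  growth q p (fun j i => S i j) (fun j i => gb i j) (fun j i => ga i j).
Proof.
move=> G; split; [exact: (growth_b G)|exact: (growth_a G)|].
move=> j i lt_jq lt_ip; have := growth_cell G lt_ip lt_jq.
rewrite /cell; case: ifP => a [-> ->]; first by rewrite a.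
case: ifP => // a'; exfalso.
have Gb := growth_b G lt_ip.
have /negP[] := chain_new Gb lt_jq.
have Sa : S i.+1 j (ga i j).
  exact: (chain_mem (growth_a G (ltnW lt_jq)) (ltnSn i) lt_ip).
have := chain_quad Gb lt_jq; move: a' Sa.
case: (ga i j) (gb i.+1 j) => r c [r' c']; rewrite adjE => a' Sa /= le.
by apply: (chain_ideal Gb (ltnW lt_jq)).2 Sa _ _ le; lia.
Qed.

Section Growth.

Variables (p q : nat) (S : nat -> nat -> pred box) (ga gb : nat -> nat -> box).
Hypothesis G : growth p q S ga gb.

Lemma chain_inward i j : i.+1 < p -> j < q ->
  chain 3 (fun s => if s is 3 then S i.+2 j.+1 else S (i + s) j)
    (triple (ga i j) (ga i.+1 j) (gb i.+2 j)).
Proof.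
move=> lt_ip lt_jq; have Ga := growth_a G (ltnW lt_jq); have Gb := growth_b G lt_ip.
split=> [] [|[|[|[|s]]]] //=; rewrite ?addn0 ?addn1 ?addn2.
- by move=> _; apply: (chain_ideal Ga); lia.
- by move=> _; apply: (chain_ideal Ga); lia.
- by move=> _; apply: (chain_ideal Ga); lia.
- by move=> _; apply: (chain_ideal Gb); lia.
- by move=> _; apply: (chain_step Ga); lia.
- by move=> _; apply: (chain_step Ga); lia.
- by move=> _; apply: (chain_step Gb); lia.
- by move=> _; apply: (chain_new Ga); lia.
- by move=> _; apply: (chain_new Ga); lia.
- by move=> _; apply: (chain_new Gb); lia.
Qed.

Lemma chain_outward i j : i < p -> j.+1 < q ->
  chain 3 (fun s => if s is s'.+1 then S i.+1 (j + s') else S i j)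
    (triple (ga i j) (gb i.+1 j) (gb i.+1 j.+1)).
Proof.
move=> lt_ip lt_jq; have Gb := growth_b G lt_ip.
have Ga : chain p (S^~ j) (ga^~ j) by apply: (growth_a G); lia.
split=> [] [|[|[|[|s]]]] //=; rewrite ?addn0 ?addn1 ?addn2.
- by move=> _; apply: (chain_ideal Ga); lia.
- by move=> _; apply: (chain_ideal Gb); lia.
- by move=> _; apply: (chain_ideal Gb); lia.
- by move=> _; apply: (chain_ideal Gb); lia.
- by move=> _; apply: (chain_step Ga); lia.
- by move=> _; apply: (chain_step Gb); lia.
- by move=> _; apply: (chain_step Gb); lia.
- by move=> _; apply: (chain_new Ga); lia.
- by move=> _; apply: (chain_new Gb); lia.
- by move=> _; apply: (chain_new Gb); lia.
Qed.

Lemma ga_step i j : i < p -> j < q ->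
  (ga i j).1 <= (ga i j.+1).1 /\ (ga i j).2 <= (ga i j.+1).2.
Proof.
move=> lt_ip lt_jq; have := growth_cell G lt_ip lt_jq; rewrite /cell.
case: ifP => [|_ [_ ->]] //; case: (ga i j) (gb i.+1 j) => r c [r' c'].
by rewrite adjE => a [_ ->] /=; lia.
Qed.

Lemma ga_mono i j j' : i < p -> j <= j' -> j' <= q ->
  (ga i j).1 <= (ga i j').1 /\ (ga i j).2 <= (ga i j').2.
Proof.
move=> lt_ip; elim: j' => [|j' IH]; first by rewrite leqn0 => /eqP->.
rewrite leq_eqVlt => /orP[/eqP->//|le_j] lt_jq.
have := ga_step lt_ip lt_jq; have := IH le_j (ltnW lt_jq); lia.
Qed.

Let ka j := descents p (ga^~ j).
Let kb i := descents q (gb i).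

(** At a corner of this kind, the column of a's gains a descent; see
[level_a_step]. *)
Definition corner_a j : Prop := (ka j).+1 < p /\
  exists r, [/\ ga (ka j) j = (r, r), ga (ka j).+1 j = (r, r.+1)
             & gb (ka j).+2 j = (r.+1, r.+1)].

(** At a corner of this kind, the row of b's loses a descent; see
[level_b_step]. *)
Definition corner_b i : Prop := (kb i.+1) < q /\
  exists j r, [/\ kb i.+1 = j.+1, ga i j = (r, r), gb i.+1 j = (r, r.+1)
               & gb i.+1 j.+1 = (r.+1, r.+1)].

Lemma level_a_step j : j < q -> valley p (ga^~ j) ->
  valley p (ga^~ j.+1) /\ (ka j.+1 = ka j \/ ka j.+1 = (ka j).+1 /\ corner_a j).
Proof.
move=> lt_jq V; have Ga := growth_a G (ltnW lt_jq); have Ga' := growth_a G lt_jq.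
have row i : i.+1 < p -> (ga i j).1 < (ga i.+1 j).1 ->
    (ga i j.+1).1 < (ga i.+1 j.+1).1.
  move=> lt_ip; exact: (inward_row (chain_inward lt_ip lt_jq)
    (growth_cell G lt_ip lt_jq) (growth_cell G (ltnW lt_ip) lt_jq)).
have col i : i.+1 < p -> (ga i j).2 < (ga i.+1 j).2 ->
    (ga i j.+1).2 < (ga i.+1 j.+1).2 \/ i = ka j /\ corner_a j.
  move=> lt_ip lt_i; have [|[r [e1 e2 e3]]] := inward_col (chain_inward lt_ip lt_jq)
    (growth_cell G lt_ip lt_jq) (growth_cell G (ltnW lt_ip) lt_jq) lt_i; first by left.
  have e : i = ka j by apply: (valley_diag Ga V (ltnW lt_ip)); rewrite e1.
  by right; split=> //; rewrite /corner_a -e; split=> //; exists r.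
have le_k := descents_le p (ga^~ j); rewrite -/(ka j) in le_k.
have rows i : i < ka j -> (ga i j.+1).1 < (ga i.+1 j.+1).1.
  by move=> lt_i; apply: row; [lia|exact: (descents_lt lt_i)].
case: (boolP ((ka j).+1 < p)) => [lt_kp|ge_kp]; last first.
  have [|V' e'] := @valley_intro p _ _ (ka j) Ga' le_k rows.
  - by move=> i le_i lt_ip; exfalso; lia.
  by split=> //; left; rewrite -e'.
have [ltk|[_ cor]] := col _ lt_kp (V _ (leqnn _) lt_kp).
  have [|V' e'] := @valley_intro p _ _ (ka j) Ga' le_k rows; last by split=> //; left; rewrite -e'.
  move=> i; rewrite leq_eqVlt => /orP[/eqP<-//|lt_ki] lt_ip.
  have [//|[e _]] := col i lt_ip (V _ (ltnW lt_ki) lt_ip).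
  by move: lt_ki; rewrite e ltnn.
have [|||V' e'] := @valley_intro p _ _ (ka j).+1 Ga'.
- by lia.
- move=> i; rewrite ltnS leq_eqVlt => /orP[/eqP->|]; last exact: rows.
  have := growth_cell G (ltnW lt_kp) lt_jq; have := growth_cell G lt_kp lt_jq.
  have [_ [r [-> -> ->]]] := cor.
  by rewrite /cell !adjE !eqxx orbT => -[-> ->]; rewrite adjE !eqxx => -[_ ->].
- move=> i le_i lt_ip.
  have [//|[e _]] := col i lt_ip (V _ (ltnW le_i) lt_ip).
  by move: le_i; rewrite e ltnn.
by split=> //; right.
Qed.

Lemma level_b_step i : i < p -> valley q (gb i.+1) ->
  valley q (gb i) /\ (kb i = kb i.+1 \/ kb i.+1 = (kb i).+1 /\ corner_b i).
Proof.
move=> lt_ip V; have Gb := growth_b G lt_ip; have Gb' := growth_b G (ltnW lt_ip).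
have col j : j.+1 < q -> (gb i.+1 j).2 < (gb i.+1 j.+1).2 ->
    (gb i j).2 < (gb i j.+1).2.
  move=> lt_jq; exact: (outward_col (chain_outward lt_ip lt_jq)
    (growth_cell G lt_ip (ltnW lt_jq)) (growth_cell G lt_ip lt_jq)).
have row j : j.+1 < q -> (gb i.+1 j).1 < (gb i.+1 j.+1).1 ->
    (gb i j).1 < (gb i j.+1).1 \/ kb i.+1 = j.+1 /\ corner_b i.
  move=> lt_jq lt_j; have [|[r [e1 e2 e3]]] := outward_row (chain_outward lt_ip lt_jq)
    (growth_cell G lt_ip (ltnW lt_jq)) (growth_cell G lt_ip lt_jq) lt_j; first by left.
  have e : j.+1 = kb i.+1 by apply: (valley_diag Gb V lt_jq); rewrite e3.
  by right; split=> //; rewrite /corner_b -e; split=> //; exists j, r.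
have le_k := descents_le q (gb i.+1); rewrite -/(kb i.+1) in le_k.
have cols j : kb i.+1 <= j -> j.+1 < q -> (gb i j).2 < (gb i j.+1).2.
  by move=> le_j lt_jq; apply: col => //; exact: V.
case E: (kb i.+1) => [|k].
  have [||//|V' e'] := @valley_intro q _ _ 0 Gb' => //.
    by move=> j _; apply: cols; rewrite E.
  by split=> //; left; rewrite -e'.
have lt_kq : k.+1 < q by lia.
have lt_k : k < kb i.+1 by rewrite E.
have [ltk|[_ cor]] := row _ lt_kq (descents_lt lt_k).
  have [|||V' e'] := @valley_intro q _ _ k.+1 Gb'; [by lia| | |by split=> //; left; rewrite -e'].
  - move=> j; rewrite ltnS leq_eqVlt => /orP[/eqP->//|lt_j].
    have [||//|[e _]] := row j; [lia|by apply: (@descents_lt q); rewrite -/(kb i.+1) E; lia|].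
    by lia.
  - by move=> j le_j; apply: cols; rewrite E.
have [|||V' e'] := @valley_intro q _ _ k Gb'; [by lia| | |by split=> //; right; rewrite -e'].
- move=> j lt_j; have [||//|[e _]] := row j; [lia|by apply: (@descents_lt q); rewrite -/(kb i.+1) E; lia|].
  by lia.
- move=> j; rewrite leq_eqVlt => /orP[/eqP<- _|]; last by move=> ? ?; apply: cols; rewrite ?E.
  have := growth_cell G lt_ip lt_kq; have := growth_cell G lt_ip (ltnW lt_kq).
  have [_ [k' [r []]]] := cor; rewrite E => -[<-] -> -> ->.
  by rewrite /cell !adjE !eqxx => -[-> ->]; rewrite adjE !eqxx orbT => -[-> _].
Qed.

Hypothesis Va : valley p (ga^~ 0).
Hypothesis Vb : valley q (gb p).

Lemma valley_a j : j <= q -> valley p (ga^~ j).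
Proof.
by elim: j => // j IH lt_jq; case: (level_a_step lt_jq (IH (ltnW lt_jq))).
Qed.

Lemma valley_b i : i <= p -> valley q (gb i).
Proof.
move=> le_ip; rewrite -(subKn le_ip); elim: (p - i) (leq_subr i p) => [|n IH] le_n.
  by rewrite subn0.
have [||//] := @level_b_step (p - n.+1); first by lia.
by have -> : (p - n.+1).+1 = p - n by [lia]; apply: IH; exact: ltnW.
Qed.

Lemma ka_step j : j < q -> ka j.+1 = ka j \/ ka j.+1 = (ka j).+1 /\ corner_a j.
Proof. by move=> lt_jq; case: (level_a_step lt_jq (valley_a (ltnW lt_jq))). Qed.

Lemma kb_step i : i < p -> kb i = kb i.+1 \/ kb i.+1 = (kb i).+1 /\ corner_b i.
Proof. by move=> lt_ip; case: (level_b_step lt_ip (valley_b lt_ip)). Qed.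

Lemma ka_mono j j' : j <= j' -> j' <= q -> ka j <= ka j'.
Proof.
elim: j' => [|j' IH]; first by rewrite leqn0 => /eqP->.
rewrite leq_eqVlt => /orP[/eqP->//|le_j] lt_jq.
have := IH le_j (ltnW lt_jq); case: (ka_step lt_jq) => [->|[-> _]] //; lia.
Qed.

Lemma kb_mono i i' : i <= i' -> i' <= p -> kb i <= kb i'.
Proof.
elim: i' => [|i' IH]; first by rewrite leqn0 => /eqP->.
rewrite leq_eqVlt => /orP[/eqP->//|le_i] lt_ip.
have := IH le_i (ltnW lt_ip); case: (kb_step lt_ip) => [->|[-> _]] //; lia.
Qed.

Lemma diag_a i j : i < p -> j <= q -> (ga i j).1 = (ga i j).2 -> i = ka j.
Proof. by move=> lt_ip le_jq; exact: (valley_diag (growth_a G le_jq) (valley_a le_jq) lt_ip). Qed.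

Lemma diag_b i j : i <= p -> j < q -> (gb i j).1 = (gb i j).2 -> j = kb i.
Proof. by move=> le_ip lt_jq; exact: (valley_diag (growth_b G le_ip) (valley_b le_ip) lt_jq). Qed.

(** In a corner the box of b_j moves to the diagonal box (r, r) and stays there:
an a above (r, r) would be strictly north-west of (r, r.+1). *)
Lemma corner_cells j : j < q -> corner_a j -> exists r,
  [/\ ga (ka j) j = (r, r), ga (ka j).+1 j = (r, r.+1),
      gb (ka j).+2 j = (r.+1, r.+1),
      gb (ka j).+1 j = (r, r.+1) &
      forall i, i <= ka j -> gb i j = (r, r)].
Proof.
move=> lt_jq [lt_kp [r [e1 e2 e3]]]; exists r.
have e4 : gb (ka j).+1 j = (r, r.+1).
  by have := growth_cell G lt_kp lt_jq; rewrite e2 e3 /cell adjE !eqxx orbT => -[].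
split=> // i le_ik; rewrite -(subKn le_ik).
elim: (ka j - i) (leq_subr i (ka j)) => [|n IH] le_n.
  rewrite subn0; have := growth_cell G (ltnW lt_kp) lt_jq.
  by rewrite e1 e4 /cell adjE !eqxx => -[].
set i' := _ - _; have ei : i'.+1 = ka j - n by rewrite /i'; lia.
have lt_i : i' < ka j by lia.
have lt_ip : i' < p by lia.
have := growth_cell G lt_ip lt_jq; rewrite ei IH; last exact: ltnW.
rewrite /cell; case: ifP => [|_ [] //]; case E: (ga i' j) => [r' c']; rewrite adjE => a.
exfalso; have := valley_row lt_i (leqnn _); rewrite -/(ka j) E e1 /= => lt_r.
apply: (@valley_noSE _ _ _ (growth_a G (ltnW lt_jq)) (valley_a (ltnW lt_jq)) i' (ka j).+1) => //;
  by rewrite E e2 /=; lia.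
Qed.

(** By [corner_cells] and [valley_diag], a corner determines its index j from any
of the rows gb i, so that there is at most one. *)
Lemma corner_index j i : j < q -> corner_a j -> i <= ka j -> j = kb i.
Proof.
move=> lt_jq cor le_ik; have [r [_ _ _ _ e]] := corner_cells lt_jq cor; have lt_kp := cor.1.
by apply: diag_b => //; [lia | rewrite e].
Qed.

(** Only one corner means at most one additional descent. *)
Lemma ka_bound j : j <= q -> ka j <= ka 0 + (kb 0 < j).
Proof.
elim: j => [|j IH] lt_jq; first by rewrite addn0.
have := IH (ltnW lt_jq); case: (ka_step lt_jq) => [->|[-> cor]]; first lia.
by have <- := corner_index lt_jq cor (leq0n _); lia.
Qed.

End Growth.

(** * Construction of growth diagrams *)

Lemma adj_between (r c r' c' : nat) : r <= c -> r' <= c' -> r <= r' -> c <= c' ->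
  (r, c) != (r', c') -> ~~ adj (r, c) (r', c') ->
  exists r1 c1, [/\ r <= r1 <= r', c <= c1 <= c', r1 <= c1, (r1, c1) != (r, c) & (r1, c1) != (r', c')].
Proof.
rewrite adjE xpair_eqE => le1 le2 le3 le4 ne nadj.
have [lt_c|le_c] := ltnP c c'.
  by exists r, c.+1; rewrite !xpair_eqE; split; lia.
by exists r.+1, c; rewrite !xpair_eqE; split; lia.
Qed.

Section Build.

Variables (p q : nat) (SA SB : nat -> pred box) (xa xb : nat -> box).
Hypothesis Ca : chain p SA xa.
Hypothesis Cb : chain q SB xb.
Hypothesis SAB : SA p =1 SB 0.

(** The box of a letter starting at h after it has met y 0, ..., y (j - 1). *)
Fixpoint hole (h : box) (y : nat -> box) (j : nat) : box :=
  if j is j'.+1 then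
    if adj (hole h y j') (y j') then y j' else hole h y j'
  else h.

Definition passed (h : box) (y : nat -> box) (j : nat) : box :=
  if adj (hole h y j) (y j) then hole h y j else y j.

Fixpoint pass_last (n : nat) : nat -> box :=
  if n is n'.+1 then passed (xa (p - n)) (pass_last n') else xb.

Let gb i := pass_last (p - i).
Let ga i j := hole (xa i) (gb i.+1) j.
Let S i j z := SA i z || has (fun m => z == gb i m) (iota 0 j).

Lemma gbE i j : i < p -> gb i j = passed (xa i) (gb i.+1) j.
Proof.
move=> lt_ip; rewrite /gb; have -> : p - i = (p - i.+1).+1 by lia.
by rewrite /=; congr (passed (xa _)); lia.
Qed.

Lemma SbE i j z : S i j.+1 z = (z == gb i j) || S i j z.
Proof. by rewrite /S -[j.+1]addn1 iotaD has_cat /= orbF add0n; case: (z == _); rewrite ?orbT ?orbF. Qed.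

Lemma cell_build i j : i < p -> cell (ga i j) (gb i.+1 j) (gb i j) (ga i j.+1).
Proof. by move=> lt_ip; rewrite /cell (gbE j lt_ip) /passed /ga /=; case: ifP => ->. Qed.

(** The new sets are ideals: if h and y are not adjacent, then h is not below y
in the order, since a box between them would lie in S i j and force h into it. *)
Lemma row_build i : i < p -> chain q (S i.+1) (gb i.+1) ->
  chain q (S i) (gb i) /\ forall j, j <= q ->
    (forall z, S i.+1 j z = (z == ga i j) || S i j z) /\ ~~ S i j (ga i j).
Proof.
move=> lt_ip R.
have new j : j < q -> (forall z, S i.+1 j z = (z == ga i j) || S i j z) -> ~~ S i j (ga i j) ->
    ~~ S i j (gb i j).
  move=> lt_jq st nw; have := cell_build j lt_ip; rewrite /cell; case: ifP => _ [-> _] //.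
  by have := chain_new R lt_jq; rewrite st negb_or => /andP[].
have H j : j <= q -> [/\ ideal (S i j), forall z, S i.+1 j z = (z == ga i j) || S i j z
    & ~~ S i j (ga i j)].
  elim: j => [_|j IH lt_jq].
    split.
    - have [I1 I2] := chain_ideal Ca (ltnW lt_ip).
      split=> [r c|r c r' c']; rewrite /S /= !orbF; [exact: I1|exact: I2].
    - by move=> z; rewrite /S /= !orbF (chain_step Ca).
    - by rewrite /S /= orbF (chain_new Ca).
  have [I st nw] := IH (ltnW lt_jq).
  have := cell_build j lt_ip; have newy := chain_new R lt_jq.
  rewrite /cell; case: ifP => ad [eb ea].
    have e z : S i j.+1 z = S i.+1 j z by rewrite SbE eb st.
    have [I1 I2] := chain_ideal R (ltnW lt_jq); split.
    - by split=> [r c|r c r' c']; rewrite !e; [exact: I1|exact: I2].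
    - by move=> z; rewrite e ea (chain_step R).
    - by rewrite e ea.
  have newy' := newy; rewrite st negb_or in newy'; case/andP: newy' => ne newy'.
  split.
  - have I' := chain_ideal R lt_jq.
    have SE z : S i.+1 j.+1 z = [|| z == gb i.+1 j, z == ga i j | S i j z].
      by rewrite (chain_step R) // st.
    split=> [r c|r c r' c'].
      by rewrite SbE eb => Sz; apply: I'.1; rewrite SE; case/orP: Sz => ->; rewrite ?orbT.
    rewrite !SbE eb => /orP[/eqP e|Sz] le1 le2 le3; last by rewrite (I.2 _ _ _ _ Sz) ?orbT.
    have Sy : S i.+1 j.+1 (r', c') by rewrite SE e eqxx.
    have := I'.2 _ _ _ _ Sy le1 le2 le3; rewrite SE => /or3P[->//|/eqP eh|->]; last by rewrite orbT.
    have le4 := I'.1 _ _ Sy.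
    have [||r1 [c1 [/andP[l1 l2] /andP[l3 l4] l5 n1 n2]]] := adj_between le3 le4 le1 le2.
    - by rewrite eh e eq_sym.
    - by rewrite eh e ad.
    have := I'.2 _ _ _ _ Sy l2 l4 l5; rewrite SE -e -eh (negPf n1) (negPf n2) /= => S1.
    by move: nw; rewrite -eh (I.2 _ _ _ _ S1).
  - by move=> z; rewrite (chain_step R) // st SbE eb ea; do ?case: (_ == _).
  - by rewrite SbE ea eb negb_or eq_sym ne.
split; last by move=> j le_j; have [] := H j le_j.
split.
- by move=> j /H[].
- by move=> j lt_jq z; rewrite SbE.
- by move=> j lt_jq; have [_ st nw] := H j (ltnW lt_jq); apply: new.
Qed.

Lemma growth_exists : exists S ga gb, [/\ growth p q S ga gb, ga^~ 0 = xa, gb p = xb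
  & S 0 0 =1 SA 0].
Proof.
exists S, ga, gb; have gbp : gb p = xb by rewrite /gb subnn.
have rows n : n <= p -> chain q (S (p - n)) (gb (p - n)).
  elim: n => [_|n IH lt_np].
    rewrite subn0 gbp.
    have e j z : j <= q -> S p j z = SB j z.
      elim: j => [_|j IH lt_jq]; first by rewrite /S /= orbF SAB.
      by rewrite SbE IH ?(ltnW lt_jq) // (chain_step Cb) // gbp.
    split=> [j le_jq|j lt_jq z|j lt_jq].
    - have [I1 I2] := chain_ideal Cb le_jq.
      by split=> [r c|r c r' c']; rewrite !e //; [exact: I1|exact: I2].
    - by rewrite !e ?(ltnW lt_jq) // (chain_step Cb).
    - by rewrite e ?(ltnW lt_jq) // (chain_new Cb).
  have en : (p - n.+1).+1 = p - n by lia.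
  have [||] := @row_build (p - n.+1); rewrite ?en //; [lia|exact: IH (ltnW lt_np)].
have row i : i <= p -> chain q (S i) (gb i).
  by move=> le_ip; rewrite -(subKn le_ip); apply: rows; rewrite leq_subr.
split=> //; last by move=> z; rewrite /S /= orbF.
split=> //; last by move=> i j lt_ip _; exact: cell_build.
move=> j le_jq; split.
- by move=> i le_ip; exact: chain_ideal (row i le_ip) _ le_jq.
- by move=> i lt_ip z; have [_ /(_ j le_jq)[]] := row_build lt_ip (row _ lt_ip).
- by move=> i lt_ip; have [_ /(_ j le_jq)[]] := row_build lt_ip (row _ lt_ip).
Qed.

End Build.

(** * The switching process in a growth diagram *)

Definition upd (f : nat -> nat) (i v : nat) : nat -> nat :=
  fun k => if k == i then v else f k.

Section Algorithm.

Variables (a b : nat) (p q : nat) (S : nat -> nat -> pred box).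
Variables (ga gb : nat -> nat -> box).
Hypothesis neq_ab : a != b.
Hypothesis G : growth p q S ga gb.
Hypothesis Va : valley p (ga^~ 0).
Hypothesis Vb : valley q (gb p).

Let ka j := descents p (ga^~ j).
Let kb i := descents q (gb i).

Implicit Types lev bl : nat -> nat.

(** A lattice path: lev i is the number of b's that a_i has passed, and bl j the
number of a's still in front of b_j. *)
Record path_state lev bl : Prop := {
  lev_le : forall i, i < p -> lev i <= q;
  bl_le : forall j, j < q -> bl j <= p;
  lev_bl : forall i j, i < p -> j < q -> (lev i <= j) = (i < bl j)
}.

(** The filling read off from a lattice path.  The priming of a letter is the one
which belongs to the row or column of the diagram where its box stands. *)
Record displays T lev bl : Prop := {
  disp_a : forall i, i < p -> T.[? ga i (lev i)] = Some (a, i < ka (lev i));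
  disp_b : forall j, j < q -> T.[? gb (bl j) j] = Some (b, j < kb (bl j));
  disp_dom : forall x, x \in domf T ->
    (exists2 i, i < p & x = ga i (lev i)) \/ (exists2 j, j < q & x = gb (bl j) j)
}.

Section State.

Variables (T : filling) (lev bl : nat -> nat).
Hypothesis st : path_state lev bl.
Hypothesis D : displays T lev bl.

Lemma lev_mono i i' : i <= i' -> i' < p -> lev i <= lev i'.
Proof.
rewrite leq_eqVlt => /orP[/eqP->//|lt_i] lt_ip; have lt_ip' := ltn_trans lt_i lt_ip.
case: (ltnP (lev i') q) => [lt|]; last by apply: leq_trans (lev_le st lt_ip').
rewrite (lev_bl st) // (ltn_trans lt_i) // -(lev_bl st) //.
Qed.

Lemma bl_mono j j' : j <= j' -> j' < q -> bl j <= bl j'.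
Proof.
move=> le_j lt_jq; have lt_jq' := leq_ltn_trans le_j lt_jq.
case: (posnP (bl j)) => [->//|gt0].
have lt_p : (bl j).-1 < p by have := bl_le st lt_jq'; lia.
have : lev (bl j).-1 <= j by rewrite (lev_bl st) // prednK.
by move/leq_trans => /(_ _ le_j); rewrite (lev_bl st) // prednK.
Qed.

Lemma bl_succ i j : i < p -> j < q -> lev i <= j ->
  (i.+1 < p -> j < lev i.+1) -> bl j = i.+1.
Proof.
move=> lt_ip lt_jq le_j lt_j.
apply/eqP; rewrite eqn_leq andbC -(lev_bl st) // le_j /= leqNgt; apply/negP => lt_i.
have lt_i1p : i.+1 < p by have := bl_le st lt_jq; lia.
by move: lt_i; rewrite -(lev_bl st) // leqNgt lt_j.
Qed.

Lemma pos_ba i j : i < p -> j < q -> bl j <= i -> S i (lev i) (gb (bl j) j).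
Proof.
move=> lt_ip lt_jq le_i; have lt_j : j < lev i by rewrite ltnNge (lev_bl st) // -leqNgt.
have := chain_mem (growth_b G (bl_le st lt_jq)) (ltnSn j) lt_jq.
apply: (growth_sub G) => //; [exact: ltnW|exact: (lev_le st)].
Qed.

Lemma pos_aa i i' : i < i' -> i' < p -> S i' (lev i') (ga i (lev i)).
Proof.
move=> lt_i lt_ip; have lt_ip' := ltn_trans lt_i lt_ip.
have := chain_mem (growth_a G (lev_le st lt_ip')) (ltnSn i) lt_ip'.
apply: (growth_sub G) => //; [exact: ltnW|exact: (lev_mono (ltnW lt_i))|exact: (lev_le st)].
Qed.

Lemma pos_bb j j' : j < j' -> j' < q -> S (bl j') j' (gb (bl j) j).
Proof.
move=> lt_j lt_jq; have lt_jq' := ltn_trans lt_j lt_jq.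
have := chain_mem (growth_b G (bl_le st lt_jq')) (ltnSn j) lt_jq'.
apply: (growth_sub G) => //; [exact: (bl_mono (ltnW lt_j))|exact: (bl_le st)|exact: ltnW].
Qed.

Lemma a_inj i i' : i < p -> i' < p -> ga i (lev i) = ga i' (lev i') -> i = i'.
Proof.
wlog lt_i : i i' / i < i' => [W|] lt_ip lt_ip' e.
  by case: (ltngtP i i') => // lt; [|apply/esym]; apply: W.
have := chain_new (growth_a G (lev_le st lt_ip')) lt_ip'.
by rewrite -e (pos_aa lt_i).
Qed.

Lemma b_inj j j' : j < q -> j' < q -> gb (bl j) j = gb (bl j') j' -> j = j'.
Proof.
wlog lt_j : j j' / j < j' => [W|] lt_jq lt_jq' e.
  by case: (ltngtP j j') => // lt; [|apply/esym]; apply: W.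
have := chain_new (growth_b G (bl_le st lt_jq')) lt_jq'.
by rewrite -e (pos_bb lt_j).
Qed.

Lemma ab_neq i j : i < p -> j < q -> ga i (lev i) != gb (bl j) j.
Proof.
move=> lt_ip lt_jq; apply/eqP => e; move: neq_ab.
by have := disp_a D lt_ip; rewrite e (disp_b D) // => -[->]; rewrite eqxx.
Qed.

Lemma value_a x : has_value a T x ->
  exists2 i, i < p & x = ga i (lev i).
Proof.
rewrite /has_value; case: fndP => // xT.
case: (disp_dom D xT) => // -[j lt_jq e].
have := disp_b D lt_jq; rewrite -e (in_fnd xT) => -[->] /= /eqP eab.
by move: neq_ab; rewrite eab eqxx.
Qed.

Lemma value_b x : has_value b T x ->
  exists2 j, j < q & x = gb (bl j) j.
Proof.
rewrite /has_value; case: fndP => // xT.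
case: (disp_dom D xT) => // -[i lt_ip e].
have := disp_a D lt_ip; rewrite -e (in_fnd xT) => -[->] /= /eqP eab.
by move: neq_ab; rewrite eab eqxx.
Qed.

Lemma a_value i : i < p -> has_value a T (ga i (lev i)).
Proof. by move=> lt_ip; rewrite /has_value (disp_a D lt_ip) /=. Qed.

Lemma b_value j : j < q -> has_value b T (gb (bl j) j).
Proof. by move=> lt_jq; rewrite /has_value (disp_b D lt_jq) /=. Qed.

Lemma after_ab i j : i < p -> j < q ->
  (ga i (lev i)).1 <= (gb (bl j) j).1 -> (ga i (lev i)).2 <= (gb (bl j) j).2 ->
  i < bl j.
Proof.
move=> lt_ip lt_jq le1 le2; rewrite ltnNge; apply/negP => le_i.
have Ga := growth_a G (lev_le st lt_ip).
have /negP[] := chain_new Ga lt_ip; have := pos_ba lt_ip lt_jq le_i.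
have := chain_quad Ga lt_ip.
case: (ga i (lev i)) (gb (bl j) j) le1 le2 => r c [r' c'] /= le1 le2 le3 Sb.
exact: (chain_ideal Ga (ltnW lt_ip)).2 Sb le1 le2 le3.
Qed.

Lemma after_aa i i' : i < p -> i' < p -> i != i' ->
  (ga i (lev i)).1 <= (ga i' (lev i')).1 -> (ga i (lev i)).2 <= (ga i' (lev i')).2 ->
  i < i'.
Proof.
move=> lt_ip lt_ip' ne le1 le2; rewrite ltn_neqAle ne /= leqNgt; apply/negP => lt_i.
have Ga := growth_a G (lev_le st lt_ip).
have /negP[] := chain_new Ga lt_ip; have := pos_aa lt_i lt_ip.
have := chain_quad Ga lt_ip.
case: (ga i (lev i)) (ga i' (lev i')) le1 le2 => r c [r' c'] /= le1 le2 le3 Sb.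
exact: (chain_ideal Ga (ltnW lt_ip)).2 Sb le1 le2 le3.
Qed.

Lemma switchable_adj i : i < p -> switchable a b T (ga i (lev i)) ->
  exists j, [/\ j < q, i < bl j & adj (ga i (lev i)) (gb (bl j) j)].
Proof.
move=> lt_ip /andP[_ /orP[]] /value_b[j lt_jq e]; exists j; (split=> //; last
    by rewrite -e /adj eqxx ?orbT);
  by apply: after_ab => //; rewrite -e /=.
Qed.

Lemma adj_switchable i j : i < p -> j < q ->
  adj (ga i (lev i)) (gb (bl j) j) -> switchable a b T (ga i (lev i)).
Proof.
move=> lt_ip lt_jq; rewrite /switchable a_value // /adj => /orP[] /eqP <-;
  by rewrite b_value ?orbT.
Qed.

End State.

(** Both outcomes of the local rule permute the same two boxes, so a filling
which differs from T at most on them displays the next path. *)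
Lemma displays_flip T T' lev bl i j :
  path_state lev bl -> displays T lev bl -> i < p -> j < q ->
  lev i = j -> bl j = i.+1 ->
  (forall z, T'.[? z] =
     if z == ga i j.+1 then Some (a, i < ka j.+1)
     else if z == gb i j then Some (b, j < kb i) else T.[? z]) ->
  path_state (upd lev i j.+1) (upd bl j i) /\
  displays T' (upd lev i j.+1) (upd bl j i).
Proof.
move=> st D lt_ip lt_jq elev ebl eT'.
have old z : (z == ga i j.+1) || (z == gb i j) =
    (z == ga i (lev i)) || (z == gb (bl j) j).
  have := growth_cell G lt_ip lt_jq; rewrite elev ebl /cell.
  by case: ifP => _ [-> ->] //; rewrite orbC.
have ne : gb i j != ga i j.+1.
  have := ab_neq D lt_ip lt_jq; have := growth_cell G lt_ip lt_jq.
  by rewrite elev ebl /cell; case: ifP => _ [-> ->] //; rewrite eq_sym.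
split.
  split=> [i' lt_ip'|j' lt_jq'|i' j' lt_ip' lt_jq']; rewrite /upd.
  - by case: eqP => // _; exact: (lev_le st).
  - by case: eqP => // _; [exact: ltnW|exact: (bl_le st)].
  - have := lev_bl st lt_ip' lt_jq'.
    case: (i' =P i) => [->|?]; case: (j' =P j) => [->|?] e; rewrite ?elev ?ebl in e.
    + by rewrite !ltnn.
    + lia.
    + lia.
    + by [].
split=> [i' lt_ip'|j' lt_jq'|x].
- rewrite /upd; case: eqP => [->|/eqP nei]; first by rewrite eT' eqxx.
  have /norP[/negPf e1 /negPf e2] : ~~ ((ga i' (lev i') == ga i j.+1) || (ga i' (lev i') == gb i j)).
    rewrite old negb_or (ab_neq D) // andbT; apply: contra nei => /eqP e.
    by apply/eqP; apply: (a_inj st) e.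
  by rewrite eT' e1 e2 (disp_a D).
- rewrite /upd; case: eqP => [->|/eqP nej]; first by rewrite eT' (negPf ne) eqxx.
  have /norP[/negPf e1 /negPf e2] : ~~ ((gb (bl j') j' == ga i j.+1) || (gb (bl j') j' == gb i j)).
    rewrite old negb_or eq_sym (ab_neq D) //=; apply: contra nej => /eqP e.
    by apply/eqP; apply: (b_inj st) e.
  by rewrite eT' e1 e2 (disp_b D).
- rewrite -fndSome eT'; have := old x.
  case: eqP => [-> _ _|_]; first by left; exists i; rewrite // /upd eqxx.
  case: eqP => [-> _ _|_ /esym/norP[/eqP ne1 /eqP ne2]].
    by right; exists j; rewrite // /upd eqxx.
  rewrite fndSome => /(disp_dom D)[[i' lt_ip' e]|[j' lt_jq' e]].
    left; exists i'; rewrite // /upd; case: eqP => // ei.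
    by case: ne1; rewrite e ei.
  right; exists j'; rewrite // /upd; case: eqP => // ej.
  by case: ne2; rewrite e ej.
Qed.

(** (S4) and (S7) move two a's at once, across the two cells of a corner.  A path
which crosses only the outer one of them would display an a with the wrong priming;
such paths do not occur. *)
Definition corners_together lev : Prop :=
  forall j, j < q -> corner_a p ga gb j ->
    lev (ka j) <= j -> lev (ka j).+1 <= j.

Record good T lev bl : Prop := {
  good_state : path_state lev bl;
  good_disp : displays T lev bl;
  good_corner : corners_together lev
}.

(** Corners consist of cells in which the two letters are adjacent, so passing a
non-adjacent letter does not affect any prime. *)
Lemma ka_stay i j : i < p -> j < q -> ~~ adj (ga i j) (gb i.+1 j) ->
  (i < ka j.+1) = (i < ka j).
Proof.
move=> lt_ip lt_jq nadj; case: (ka_step G Va lt_jq) => [|[ek cor]].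
  by rewrite -/(ka j) -/(ka j.+1) => ->.
rewrite /ka ek ltnS leq_eqVlt; case: eqP => //= e; exfalso.
have [r [e1 _ _ e4 _]] := corner_cells G Va lt_jq cor.
by move: nadj; rewrite e e1 e4 adjE !eqxx.
Qed.

Lemma kb_stay i j : i < p -> j < q -> ~~ adj (ga i j) (gb i.+1 j) ->
  (j < kb i) = (j < kb i.+1).
Proof.
move=> lt_ip lt_jq nadj; case: (kb_step G Vb lt_ip) => [|[ek cor]].
  by rewrite -/(kb i) -/(kb i.+1) => ->.
rewrite /kb ek ltnS [in RHS]leq_eqVlt; case: eqP => //= e; exfalso.
have [_ [j' [r [ej' e1 e2 _]]]] := cor.
have ej : j' = j by move: ej'; rewrite ek e => -[].
by move: nadj; rewrite -ej e1 e2 adjE !eqxx.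
Qed.

(** Crossing cells whose letters are not adjacent changes the path but not the
filling. *)
Lemma good_raise T lev bl i m : good T lev bl -> i < p -> lev i <= m -> m <= q ->
  (forall j, lev i <= j -> j < m ->
     bl j = i.+1 /\ ~~ adj (ga i (lev i)) (gb i.+1 j)) ->
  exists lev' bl', [/\ good T lev' bl', lev' i = m, ga i m = ga i (lev i)
    & forall i', i' != i -> lev' i' = lev i'].
Proof.
move=> [st D cor] lt_ip; elim: m => [|m IH].
  by rewrite leqn0 => /eqP e _ _; exists lev, bl; split; rewrite ?e.
rewrite leq_eqVlt => /orP[/eqP<-|lt_m] lt_mq nadj; first by exists lev, bl.
have [|||lev1 [bl1 [[st1 D1 cor1] e1 ega same]]] := IH; [lia..| |].
  by move=> j le_j lt_j; apply: nadj => //; exact: leqW.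
have [ebl na] := nadj m lt_m (ltnSn m).
have ebl1 : bl1 m = i.+1.
  apply: (bl_succ st1 lt_ip lt_mq); first by rewrite e1.
  move=> lt_i1p; have := lev_bl st lt_i1p lt_mq; rewrite ebl ltnn same; lia.
have na' : ~~ adj (ga i m) (gb i.+1 m) by rewrite ega.
have := growth_cell G lt_ip lt_mq; rewrite /cell (negPf na') => -[eb ea].
have [|st2 D2] := displays_flip (T' := T) st1 D1 lt_ip lt_mq e1 ebl1.
  move=> z; rewrite ka_stay // kb_stay // ea eb.
  case: eqP => [->|_]; first by rewrite -[in LHS]e1 (disp_a D1) // e1.
  by case: eqP => [->|//]; rewrite -ebl1 (disp_b D1).
exists (upd lev1 i m.+1), (upd bl1 m i); split.
- split=> // j lt_jq cj; rewrite /upd.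
  case: eqP => [ei|_]; case: eqP => [ei'|_]; try lia.
  + by move=> le_j; have := cor1 j lt_jq cj; rewrite ei e1; lia.
  + move=> le_j; have := cor1 j lt_jq cj le_j; rewrite ei' e1 => le_mj.
    rewrite ltn_neqAle le_mj andbT; apply/eqP => em.
    have [r [_ e3 e4 _ _]] := corner_cells G Va lt_jq cj.
    have [_ [r' [_ e3' e4']]] := cj.
    by move: na'; rewrite em -ei' /ka e3 e4 adjE !eqxx orbT.
  + exact: cor1.
- by rewrite /upd eqxx.
- by rewrite ea.
- by move=> i' ne; rewrite /upd (negPf ne) same.
Qed.

(** An a without neighbouring b has no adjacent b to pass any more, so the path
may be assumed to have crossed all its cells. *)
Lemma good_normalize T lev bl i : good T lev bl -> i <= p ->
  (forall l, i <= l -> l < p -> ~~ switchable a b T (ga l (lev l))) ->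
  exists lev' bl', [/\ good T lev' bl',
     forall l, i <= l -> l < p -> lev' l = q,
     forall l, l < i -> lev' l = lev l &
     forall l, l < p -> ga l (lev' l) = ga l (lev l)].
Proof.
move=> gd le_ip; rewrite -(subKn le_ip); elim: (p - i) (leq_subr i p) => [|n IH] le_n.
  by move=> _; exists lev, bl; split=> // l; lia.
set i1 := p - n.+1; have ei : p - n = i1.+1 by rewrite /i1; lia.
have lt_ip : i1 < p by rewrite /i1; lia.
rewrite ei in IH => nsw.
have [|lev1 [bl1 [gd1 full same ega]]] := IH (ltnW le_n).
  by move=> l le_l; apply: nsw; exact: ltnW.
have [st1 D1 _] := gd1.
have [|//||lev2 [bl2 [gd2 e2 ega2 same2]]] := @good_raise T lev1 bl1 i1 q gd1 lt_ip.
- exact: (lev_le st1).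
- move=> j le_j lt_jq.
  have ebl1 : bl1 j = i1.+1.
    by apply: (bl_succ st1 lt_ip lt_jq le_j) => lt_i1p; rewrite full.
  split=> //; apply: contra (nsw _ (leqnn _) lt_ip) => ad.
  rewrite -(ega _ lt_ip); apply: (adj_switchable D1 lt_ip lt_jq).
  by rewrite ebl1.
exists lev2, bl2; split=> // l.
- rewrite leq_eqVlt => /orP[/eqP<- //|lt_l] lt_lp; rewrite same2 ?full //; lia.
- by move=> lt_l; rewrite same2 ?same //; lia.
- move=> lt_lp; rewrite -ega //; case: (l =P i1) => [->|/eqP ne]; first by rewrite e2.
  by rewrite same2.
Qed.

Lemma next_box_none T : next_box a b T = None -> forall x, ~~ switchable a b T x.
Proof.
move=> none x; apply/negP => sw.
have xT : x \in domf T.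
  by move: sw => /andP[]; rewrite /has_value; case: fndP.
move: none; rewrite /next_box.
set cand := (fun pr : bool => [pred x : domf T |
  switchable a b T (val x) && (has_prime T (val x) == pr)]); cbv zeta.
case: pickP => // no1; case: pickP => // no2 _.
(* If no candidate is extremal, there is no candidate. *)
have no (pr : bool) (f : box -> nat) :
    (forall y0 : domf T, cand pr y0 && [forall y, cand pr y ==> (f (val y) <= f (val y0))] = false) ->
    forall y, cand pr y = false.
  move=> H y; apply/negP => cy.
  have := H [arg max_(z > y | cand pr z) f (val z)]; case: arg_maxnP => // z cz zmax /negP[].
  by rewrite cz; apply/forallP => w; apply/implyP => /zmax.
have := no _ _ no1 [` xT]%fset; have := no _ _ no2 [` xT]%fset.
by rewrite /cand /= sw; case: has_prime.
Qed.

(** Unprimed a's are sorted by columns and primed ones by rows, even on a path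
through several columns of the diagram, because boxes only move right and down; and
primed a's precede unprimed ones by [ka_bound].  So the choice prescribed for the
process is the choice of the largest index. *)
Lemma next_box_some T lev bl x : good T lev bl -> next_box a b T = Some x ->
  exists i, [/\ i < p, x = ga i (lev i), switchable a b T x &
    forall l, i < l -> l < p -> ~~ switchable a b T (ga l (lev l))].
Proof.
move=> [st D cor].
have domT l : l < p -> ga l (lev l) \in domf T.
  by move=> lt_lp; rewrite -fndSome (disp_a D).
have prime l : l < p -> has_prime T (ga l (lev l)) = (l < ka (lev l)).
  by move=> lt_lp; rewrite /has_prime (disp_a D).
rewrite /next_box; set cand := (fun pr : bool => [pred x : domf T |
  switchable a b T (val x) && (has_prime T (val x) == pr)]); cbv zeta.
have inv (y : domf T) pr : cand pr y -> exists i, [/\ i < p, val y = ga i (lev i),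
    switchable a b T (val y) & (i < ka (lev i)) = pr].
  move=> /andP[sw /eqP epr]; have /andP[/(value_a D)[i lt_ip e] _] := sw.
  by exists i; split=> //; rewrite -prime // -e.
have mk l pr : forall lt_lp : l < p, switchable a b T (ga l (lev l)) ->
    (l < ka (lev l)) = pr -> cand pr [` domT l lt_lp]%fset.
  by move=> lt_lp sw e; rewrite /cand /= sw prime // e eqxx.
case: pickP => [y /andP[/inv[i [lt_ip e sw ei]] /forallP ymax] [<-]|no1].
  exists i; split=> // l lt_l lt_lp; apply/negP => swl.
  have le_i : ka (lev i) <= i by rewrite leqNgt ei.
  have le_lev := lev_mono st (ltnW lt_l) lt_lp.
  case el: (l < ka (lev l)).
    have := ka_bound G Va Vb (lev_le st lt_lp).
    have := ka_mono G Va (leq0n (lev i)) (lev_le st lt_ip); rewrite -/(ka _) -/(ka _).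
    by move: el le_i lt_l; rewrite /ka; lia.
  have := ymax [` domT l lt_lp]%fset; rewrite (mk _ _ lt_lp swl el) /= e.
  apply/negP; rewrite -ltnNge.
  have lt_col := valley_col (valley_a G Va (lev_le st lt_ip)) le_i lt_l lt_lp.
  exact: leq_trans lt_col (ga_mono G lt_lp le_lev (lev_le st lt_lp)).2.
case: pickP => [y /andP[/inv[i [lt_ip e sw ei]] /forallP ymax] [<-]|//].
exists i; split=> // l lt_l lt_lp; apply/negP => swl.
have le_lev := lev_mono st (ltnW lt_l) lt_lp.
case el: (l < ka (lev l)).
  have := ymax [` domT l lt_lp]%fset; rewrite (mk _ _ lt_lp swl el) /= e.
  apply/negP; rewrite -ltnNge.
  have lt_row := valley_row (x := ga^~ (lev l)) lt_l (ltnW el).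
  exact: leq_ltn_trans (ga_mono G lt_ip le_lev (lev_le st lt_lp)).1 lt_row.
have cl := mk _ _ lt_lp swl el.
have := no1 [arg max_(z > [` domT l lt_lp]%fset | cand false z) (val z).2].
case: arg_maxnP => // z cz zmax /negP[].
by rewrite cz; apply/forallP => w; apply/implyP => /zmax.
Qed.

(** The measure which bounds the number of switches. *)
Definition weight lev := \sum_(l < p) ((ga l (lev l)).1 + (ga l (lev l)).2).

(** The path normalized for the switch to come: later a's are at the end of their
way, and a_i is in front of the first b adjacent to it. *)
Record ready T lev bl i j : Prop := {
  ready_good : good T lev bl;
  ready_i : i < p;
  ready_j : j < q;
  ready_lev : lev i = j;
  ready_full : forall l, i < l -> l < p -> lev l = q;
  ready_adj : adj (ga i j) (gb i.+1 j)
}.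

Lemma weight_lt lev lev' i : i < p ->
  (forall l, l < p -> lev l <= lev' l) -> (forall l, l < p -> lev' l <= q) ->
  lev i < lev' i -> adj (ga i (lev i)) (gb i.+1 (lev i)) -> weight lev < weight lev'.
Proof.
move=> lt_ip le_lev le_q lt_lev ad.
rewrite /weight (bigD1 (Ordinal lt_ip)) //= [X in _ < X](bigD1 (Ordinal lt_ip)) //= -addSn.
apply: leq_add; last first.
  apply: leq_sum => l _.
  by have [] := ga_mono G (ltn_ord l) (le_lev l (ltn_ord l)) (le_q l (ltn_ord l)); lia.
have lt_q := leq_trans lt_lev (le_q i lt_ip).
have [] := ga_mono G lt_ip lt_lev (le_q i lt_ip).
have := growth_cell G lt_ip lt_q; rewrite /cell ad => -[_ ->].
by move: ad; case: (ga i (lev i)) (gb _ _) => r c [r' c'] /=; rewrite adjE; lia.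
Qed.

Lemma next_box_ready T lev bl x : good T lev bl -> next_box a b T = Some x ->
  exists i j lev' bl', [/\ ready T lev' bl' i j, x = ga i j & weight lev' = weight lev].
Proof.
move=> gd /(next_box_some gd)[i [lt_ip ex sw nsw]].
have [//|//|lev1 [bl1 [gd1 full same ega]]] := @good_normalize T lev bl i.+1 gd.
have [st1 D1 _] := gd1.
have sw1 : switchable a b T (ga i (lev1 i)) by rewrite ega // -ex.
have ebl1 j : lev1 i <= j -> j < q -> bl1 j = i.+1.
  move=> le_j lt_jq.
  by apply: (bl_succ st1 lt_ip lt_jq le_j) => lt_i1p; rewrite full.
have ex_j : exists j, [&& lev1 i <= j, j < q & adj (ga i (lev1 i)) (gb i.+1 j)].
  have [j [lt_jq lt_i ad]] := switchable_adj st1 D1 lt_ip sw1.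
  have le_j : lev1 i <= j by rewrite (lev_bl st1).
  by exists j; rewrite le_j lt_jq -(ebl1 j).
case: (ex_minnP ex_j) => j /and3P[le_j lt_jq ad] min_j.
have [||lev2 [bl2 [gd2 e2 ega2 same2]]] := @good_raise T lev1 bl1 i j gd1 lt_ip le_j.
- exact: ltnW.
- move=> j' le_j' lt_j'; have lt_jq' := ltn_trans lt_j' lt_jq; split; first exact: ebl1.
  by apply/negP => ad'; have := min_j j'; rewrite le_j' lt_jq' ad' => /(_ isT); lia.
have eg l : l < p -> ga l (lev2 l) = ga l (lev l).
  by move=> lt_lp; rewrite -ega //; case: (l =P i) => [->|/eqP/same2->]; rewrite ?e2.
exists i, j, lev2, bl2; split.
- split=> //; last by rewrite ega2.
  by move=> l lt_l lt_lp; rewrite same2 ?full //; lia.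
- by rewrite ex -eg // e2.
- by apply: eq_bigr => l _; rewrite eg.
Qed.

Section Ready.

Variables (T : filling) (lev bl : nat -> nat) (i j : nat).
Hypothesis R : ready T lev bl i j.
Let st := good_state (ready_good R).
Let D := good_disp (ready_good R).
Let lt_ip := ready_i R.
Let lt_jq := ready_j R.
Let x := ga i j.

Lemma ready_bl j' : j <= j' -> j' < q -> bl j' = i.+1.
Proof.
move=> le_j lt_jq'; apply: (bl_succ st lt_ip lt_jq'); first by rewrite (ready_lev R).
by move=> lt_i1p; rewrite (ready_full R).
Qed.

Lemma ready_b z : has_value b T z -> x.1 <= z.1 -> x.2 <= z.2 ->
  exists2 j', j <= j' & [/\ j' < q, z = gb i.+1 j' & T.[? z] = Some (b, j' < kb i.+1)].
Proof.
move=> /(value_b D)[j' lt_jq' e] le1 le2.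
have lt_i : i < bl j'.
  by apply: (after_ab st) => //; rewrite (ready_lev R) -?e.
have le_j : j <= j' by rewrite -(ready_lev R) (lev_bl st).
by exists j' => //; split=> //; rewrite e ?(disp_b D) // ready_bl.
Qed.

Lemma ready_x : T.[? x] = Some (a, i < ka j).
Proof. by rewrite /x -(ready_lev R) (disp_a D). Qed.

Lemma ready_y : T.[? gb i.+1 j] = Some (b, j < kb i.+1).
Proof. by rewrite -{1}(ready_bl (leqnn j) lt_jq) (disp_b D) // ready_bl. Qed.

Lemma ready_cell : gb i j = x /\ ga i j.+1 = gb i.+1 j.
Proof. by have := growth_cell G lt_ip lt_jq; rewrite /cell (ready_adj R). Qed.

Lemma ready_weight lev' bl' T' : good T' lev' bl' ->
  (forall l, l < p -> lev l <= lev' l) -> lev i < lev' i -> weight lev < weight lev'.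
Proof.
move=> gd le lt; apply: (weight_lt lt_ip) => //.
  exact: lev_le (good_state gd).
by rewrite (ready_lev R); exact: ready_adj R.
Qed.

(** The letter a_i crosses two cells, the letters b' and b of the rule being b_j and
b_(j+1).  Primes need no computation: by [valley_diag] the index of a letter on
the diagonal equals the number of primed letters. *)
Lemma step_S3 : x = diag x.1 -> T.[? right x] = Some (b, true) ->
  has_value b T (diag x.1.+1) ->
  exists lev' bl', good (swap T x (diag x.1.+1)).[right x <- (b, false)] lev' bl' /\
    weight lev < weight lev'.
Proof.
case ex: x => [r c]; rewrite /diag /right /= => -[ec]; rewrite {c}ec in ex * => eb1 bdiag.
have [|||j1 le_j1 [lt_j1 e1 T1]] := @ready_b (r, r.+1); rewrite ?ex //=.
  by rewrite /has_value eb1 /=.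
have [||j2 le_j2 [lt_j2 e2 T2]] := ready_b bdiag; rewrite ?ex //=.
have Gb := growth_b G lt_ip.
have ek : j2 = kb i.+1 by apply: (diag_b G Vb); rewrite // -e2.
have lt_j1k : j1 < kb i.+1 by move: T1; rewrite eb1 => -[].
have ej : j1 = j.
  have := chain_quad Gb lt_jq; have := ready_adj R; rewrite -/x ex.
  case ey: (gb i.+1 j) => [r' c'] /=; rewrite adjE => ad le.
  apply/esym; apply: (chain_inj Gb) => //; rewrite -e1 ey; congr pair; lia.
rewrite {}ej in e1 T1 lt_j1k *.
have ej2 : j2 = j.+1.
  apply/eqP; rewrite eqn_leq; apply/andP; split; last by rewrite ek.
  rewrite leqNgt; apply/negP => lt_j.
  have le_k : j2 <= descents q (gb i.+1) by rewrite ek.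
  have := valley_row lt_j le_k.
  have := @valley_row q (gb i.+1) j j.+1 (ltnSn j); rewrite -/(kb i.+1) -ek => /(_ (ltnW lt_j)).
  by rewrite -e1 -e2 /=; lia.
rewrite {}ej2 in ek e2 T2 lt_j2 *.
have [c1 c2] := ready_cell; rewrite -e1 in c2.
have ekb : j = kb i.
  by apply: (diag_b G Vb); [exact: ltnW|exact: lt_jq|rewrite c1 ex].
have eka : i = ka j.
  by apply: (diag_a G Va); [exact: lt_ip|exact: ltnW|rewrite -/x ex].
have [c3 c4] : gb i j.+1 = (r, r.+1) /\ ga i j.+2 = (r.+1, r.+1).
  have := growth_cell G lt_ip lt_j2.
  by rewrite c2 -e2 /cell adjE !eqxx orbT.
(* Since a_i is on the diagonal before and after, it is unprimed both times. *)
have eka2 : i = ka j.+2.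
  by apply: (diag_a G Va); [exact: lt_ip|exact: lt_j2|rewrite c4].
pose U := T.[(r, r) <- (b, j < kb i)].[(r, r.+1) <- (a, i < ka j.+1)].
have [z|st1 D1] := displays_flip (T' := U) st D lt_ip lt_jq (ready_lev R)
  (ready_bl (leqnn j) lt_jq).
  by rewrite !fnd_set c2 c1 ex.
set T' := _.[_ <- _].
have lev1 : upd lev i j.+1 i = j.+1 by rewrite /upd eqxx.
have bl1 : upd bl j i j.+1 = i.+1.
  by rewrite /upd; case: eqP => [|_]; [lia|rewrite ready_bl].
have [z|st2 D2] := displays_flip (T' := T') st1 D1 lt_ip lt_j2 lev1 bl1.
  have Tx := ready_x; rewrite ex in Tx.
  rewrite /T' /swap Tx T2 !fnd_set c3 c4 -ekb -eka2 -eka -ek !ltnn.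
  have -> : (j.+1 < j) = false by lia.
  by rewrite !box_eqE; case: z => r' c' /=; do ?[case: eqP => //= ?]; exfalso; lia.
exists (upd (upd lev i j.+1) i j.+2), (upd (upd bl j i) j.+1 i).
suff gd : good T' (upd (upd lev i j.+1) i j.+2) (upd (upd bl j i) j.+1 i).
  split=> //; apply: (ready_weight gd) => [l lt_lp|]; rewrite /upd ?eqxx ?(ready_lev R) //.
  by case: eqP => [->|_]; rewrite ?(ready_lev R); lia.
split=> // m lt_mq cm; rewrite /upd.
have cor := good_corner (ready_good R) lt_mq cm.
case: eqP => [ei|_]; case: eqP => [ei'|_]; try lia.
- by move=> le_m; apply: cor; rewrite ei (ready_lev R); lia.
- move=> /cor; rewrite ei' (ready_lev R) => le_m.
  have [r' [_ e3 _ _ _]] := corner_cells G Va lt_mq cm.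
  have em := corner_index G Va Vb lt_mq cm (leqnn _).
  have le_kb : kb (ka m) <= kb i by apply: (kb_mono G Vb); lia.
  have em' : m = j by move: em; rewrite -/(ka m) -/(kb _); lia.
  by move: e3; rewrite -/(ka m) ei' em' -/x ex => -[]; lia.
Qed.

(** (S4) and (S7) are the same step: a_i and a_(i-1) cross the cells of a
corner. *)
Lemma step_S4 : x = right (diag x.1) -> has_value a T (diag x.1) ->
  T.[? x] = Some (a, false) -> has_value b T (below x) ->
  ~~ has_value b T (right x) || (T.[? right x] == Some (b, false)) ->
  exists lev' bl', good (swap T (diag x.1) (diag x.1.+1)).[x <- (a, true)] lev' bl' /\
    weight lev < weight lev'.
Proof.
case ex: x => [r c]; rewrite /diag /right /below /=.
move=> -[ec]; rewrite {c}ec in ex * => adiag ea bbelow bright.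
have Gb := growth_b G lt_ip.
have [||jb le_jb [lt_jb eb Tb]] := ready_b bbelow; rewrite ?ex //=.
have ek : jb = kb i.+1 by apply: (diag_b G Vb); rewrite // -eb.
have ej : jb = j.
  have := ready_adj R; rewrite -/x ex.
  case ey: (gb i.+1 j) => [r' c']; rewrite adjE => /orP[]/andP[/eqP er /eqP ec].
    have := ready_y; rewrite ey er ec => Ty.
    move: bright; rewrite /has_value Ty eqxx /= => /eqP[] /negbT.
    by rewrite -leqNgt -ek; lia.
  by apply: (chain_inj Gb) => //; rewrite -eb ey er ec.
rewrite {jb}ej in le_jb lt_jb eb Tb ek.
have [i0 lt_i0p e0] := value_a D adiag.
have lt_i0 : i0 < i.
  apply: (after_aa st) => //; rewrite ?(ready_lev R) -?e0 -/x ?ex //=.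
  by apply/eqP => ei0; move: e0; rewrite ei0 (ready_lev R) -/x ex => -[]; lia.
have le_lev0 : lev i0 <= j by rewrite -(ready_lev R) (lev_mono st (ltnW lt_i0)).
have eka0 : i0 = ka (lev i0).
  by apply: (diag_a G Va); [exact: lt_i0p|exact: (lev_le st)|rewrite -e0].
have [c1 c2] := ready_cell; rewrite -eb in c2; rewrite ex in c1.
have eka : i = ka j.+1.
  by apply: (diag_a G Va); [exact: lt_ip|exact: lt_jq|rewrite c2].
have ei : i = i0.+1.
  have := ka_bound G Va Vb lt_jq; have := ka_mono G Va (leq0n (lev i0)) (lev_le st lt_i0p).
  by rewrite -/(ka _) -/(ka _) -/(ka _) -eka -eka0; lia.
have [|lev1 [bl1 [gd1 e1 ega same]]] := good_raise (ready_good R) lt_i0p le_lev0 (ltnW lt_jq).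
  move=> j' le_j' lt_j'; have lt_jq' := ltn_trans lt_j' lt_jq.
  have ebl : bl j' = i0.+1.
    by apply: (bl_succ st lt_i0p lt_jq' le_j'); rewrite -ei (ready_lev R).
  split=> //; rewrite -e0 -ei; apply/negP.
  have := ab_neq D lt_ip lt_jq'; rewrite ebl -ei (ready_lev R) -/x ex.
  have := chain_quad (growth_b G (ltnW lt_ip)) lt_jq'.
  case: (gb i j') => r' c' /= le; rewrite adjE xpair_eqE; lia.
rewrite -e0 in ega.
have [st1 D1 cor1] := gd1.
have lt_i0q : i0 != i by lia.
have lev1i : lev1 i = j by rewrite same ?(ready_lev R) // eq_sym.
have bl1j : bl1 j = i.+1.
  apply: (bl_succ st1 lt_ip lt_jq); first by rewrite lev1i.
  by move=> lt_i1p; rewrite same ?(ready_full R) //; lia.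
pose U := T.[(r, r.+1) <- (b, j < kb i)].[(r.+1, r.+1) <- (a, i < ka j.+1)].
have [z|st2 D2] := displays_flip (T' := U) st1 D1 lt_ip lt_jq lev1i bl1j.
  by rewrite !fnd_set c2 c1.
have lev2 : upd lev1 i j.+1 i0 = j by rewrite /upd (negPf lt_i0q).
have bl2 : upd bl1 j i j = i0.+1 by rewrite /upd eqxx ei.
(* The remaining cell of the corner, that of the a on the diagonal. *)
have [c3 c4] : gb i0 j = (r, r) /\ ga i0 j.+1 = (r, r.+1).
  have := growth_cell G lt_i0p lt_jq.
  by rewrite -ei c1 ega /cell adjE !eqxx.
have ekb0 : j = kb i0.
  by apply: (diag_b G Vb); [exact: ltnW|exact: lt_jq|rewrite c3].
set T' := _.[_ <- _].
have [z|st3 D3] := displays_flip (T' := T') st2 D2 lt_i0p lt_jq lev2 bl2.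
  have Tx := disp_a D lt_i0p; rewrite -e0 -eka0 ltnn in Tx.
  rewrite /T' /swap Tx Tb !fnd_set c3 c4 -ekb0 -ek -eka !ltnn lt_i0.
  by rewrite !box_eqE; case: z => r' c' /=; do ?[case: eqP => //= ?]; exfalso; lia.
exists (upd (upd lev1 i j.+1) i0 j.+1), (upd (upd bl1 j i) j i0).
suff gd : good T' (upd (upd lev1 i j.+1) i0 j.+1) (upd (upd bl1 j i) j i0).
  split=> //; apply: (ready_weight gd) => [l lt_lp|]; rewrite /upd ?eqxx.
    case: eqP => [->|/eqP ne]; first by lia.
    by case: eqP => [->|_]; rewrite ?(ready_lev R) ?same //; lia.
  by rewrite eq_sym (negPf lt_i0q) (ready_lev R).
split=> // m lt_mq cm; rewrite /upd.
have cor := cor1 m lt_mq cm.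
case: (ka m =P i0) => [ek0|ne0].
  by rewrite ek0 -ei eqxx eq_sym (negPf lt_i0q).
case: ((ka m).+1 =P i0) => [ek1|ne1].
  have -> : (ka m == i) = false by lia.
  move=> /cor; rewrite ek1 e1 => le_m; rewrite ltn_neqAle le_m andbT; apply/eqP => em.
  have := diag_a G Va lt_i0p (ltnW lt_jq); rewrite ega => /(_ erefl).
  by rewrite em -/(ka m); lia.
have -> : ((ka m).+1 == i) = false by lia.
case: (ka m =P i) => [ei1|_] le_m; apply: cor => //.
by rewrite ei1 lev1i; lia.
Qed.

(** Every other rule crosses the single cell of a_i and b_j.  If a prime changed
in it, or if it were one of the two cells of a corner that have to be crossed
together, then the conditions of (S3), (S4) or (S7) would hold. *)
Lemma step_swap :
  ~ [/\ x = diag x.1, T.[? right x] = Some (b, true) & has_value b T (diag x.1.+1)] ->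
  ~ [/\ x = right (diag x.1), has_value a T (diag x.1), T.[? x] = Some (a, false),
        has_value b T (below x)
      & ~~ has_value b T (right x) || (T.[? right x] == Some (b, false))] ->
  exists lev' bl', good (swap T x (gb i.+1 j)) lev' bl' /\ weight lev < weight lev'.
Proof.
move=> noS3 noS4; have [c1 c2] := ready_cell.
have Gb := growth_b G lt_ip.
have fa : (i < ka j.+1) = (i < ka j).
  have [|[ek cor]] := ka_step G Va lt_jq; rewrite -/(ka j) -/(ka j.+1); first by move->.
  rewrite /ka ek ltnS leq_eqVlt; case: eqP => //= ei; exfalso.
  have := good_corner (ready_good R) lt_jq cor; rewrite /ka -ei (ready_lev R) leqnn.
  have lt_i1 : i.+1 < p by have := cor.1; rewrite -ei.
  by rewrite (ready_full R (ltnSn i) lt_i1) => /(_ isT); move: lt_jq; lia.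
have fb : (j < kb i) = (j < kb i.+1).
  have [|[ek cor]] := kb_step G Vb lt_ip; rewrite -/(kb i) -/(kb i.+1); first by move->.
  rewrite /kb ek ltnS [in RHS]leq_eqVlt; case: eqP => //= ej; exfalso.
  have [lt_kq [j' [r [ej' e1 e2 e3]]]] := cor.
  have {}ej' : j' = j by move: ej'; rewrite ek ej => -[].
  rewrite ej' in e1 e2 e3; apply: noS3; rewrite /x e1 /right /diag /=.
  have lt_jq1 : j.+1 < q by move: lt_kq; rewrite ek -ej.
  have := ready_y; rewrite e2 /kb ek ej ltnSn => ->; split=> //.
  have := disp_b D lt_jq1; rewrite ready_bl // e3 /has_value => -> /=.
  exact: eqxx.
set T' := swap _ _ _.
have [z|st1 D1] := displays_flip (T' := T') st D lt_ip lt_jq (ready_lev R)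
  (ready_bl (leqnn j) lt_jq).
  have ne : x != gb i.+1 j.
    by have := ready_adj R; rewrite -/x; apply: contraL => /eqP<-; case: x => r c; rewrite adjE; lia.
  rewrite /T' /swap ready_x ready_y !fnd_set c1 c2 fa fb.
  by [].
exists (upd lev i j.+1), (upd bl j i).
suff gd : good T' (upd lev i j.+1) (upd bl j i).
  split=> //; apply: (ready_weight gd) => [l lt_lp|]; rewrite /upd ?eqxx ?(ready_lev R) //.
  by case: eqP => [->|_]; rewrite ?(ready_lev R); lia.
split=> // m lt_mq cm; rewrite /upd.
have cor := good_corner (ready_good R) lt_mq cm.
case: (ka m =P i) => [ek0|ne0].
  have -> : ((ka m).+1 == i) = false by lia.
  by move=> le_m; apply: cor; rewrite ek0 (ready_lev R); lia.
case: ((ka m).+1 =P i) => [ek1|ne1]; last exact: cor.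
move=> le_m; have := cor le_m; rewrite ek1 (ready_lev R) => le_jm.
rewrite ltn_neqAle le_jm andbT; apply/eqP => em; subst m.
have [r [e1 e2 e3 _ _]] := corner_cells G Va lt_jq cm.
have ekb := corner_index G Va Vb lt_jq cm.
rewrite -/(ka j) ek1 in e1 e2 e3.
have lt_kp : ka j < p by lia.
(* a_(i-1) cannot have reached (r, r) on the way: it would have passed a b on the
   diagonal other than b_j. *)
have stay n : n <= j - lev (ka j) -> ga (ka j) (j - n) = (r, r).
  elim: n => [|n IH] le_n; first by rewrite subn0.
  have lt_m : j - n.+1 < q by lia.
  have := growth_cell G lt_kp lt_m.
  have -> : (j - n.+1).+1 = j - n by lia.
  rewrite IH; last exact: ltnW.
  rewrite /cell ek1; case: ifP => [_ [_ e]|_ [_ <-] //]; exfalso.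
  have := diag_b G Vb (ltnW lt_ip) lt_m; rewrite -e => /(_ erefl).
  have := kb_mono G Vb (ltnW (ltnSn (ka j))); rewrite ek1 => /(_ (ltnW lt_ip)).
  have := ekb _ (leqnn (ka j)); lia.
have le_lev : lev (ka j) <= j by [].
have e4 : ga (ka j) (lev (ka j)) = (r, r) by have := stay _ (leqnn _); rewrite subKn.
have := ready_y; have := ready_x; rewrite /x e2 e3 -ek1 ltnNge leqnSn /= => Tx Ty.
have ej : j = kb i.+1 by apply: (diag_b G Vb); [exact: lt_ip|exact: lt_jq|rewrite e3].
apply: noS4; rewrite /x e2 /right /diag /below /=; split=> //.
- by rewrite -e4; exact: (a_value D lt_kp).
- by rewrite /has_value Ty /=.
- case hb: has_value => //=.
  have [||j' le_j' [_ _ ->]] := ready_b hb; rewrite ?/x ?e2 //=.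
  by rewrite -ej ltnNge le_j'.
Qed.

End Ready.

(** If a_i has two neighbouring b's, the right one comes first in the list of the b's
exactly if it is primed, since then rows increase, and columns otherwise.  Hence
(S5) and (S6) exchange a_i with the first b adjacent to it. *)
Lemma step_good T lev bl x : good T lev bl -> next_box a b T = Some x ->
  exists lev' bl', good (switch a b T x) lev' bl' /\ weight lev < weight lev'.
Proof.
move=> gd nx; have [i [j [lev1 [bl1 [R -> <-]]]]] := next_box_ready gd nx.
set y := ga i j; rewrite /switch; cbv zeta.
case: and3P => [[/eqP h1 /eqP h2 h3]|noS3]; first exact: (step_S3 R).
case: and5P => [[/eqP h1 h2 /eqP h3 h4 h5]|noS4]; first exact: (step_S4 R).
have [||lev2 [bl2 gd2]] := step_swap R.
- by case=> h1 h2 h3; apply: noS3; split=> //; apply/eqP.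
- by case=> h1 h2 h3 h4 h5; apply: noS4; split=> //; apply/eqP.
suff -> : (if has_value b T (right y) && ~~ has_value b T (below y) then swap T y (right y)
   else if has_value b T (below y) && ~~ has_value b T (right y) then swap T y (below y)
   else if has_prime T (right y) then swap T y (right y) else swap T y (below y)) =
   swap T y (gb i.+1 j) by exists lev2, bl2.
have hy : has_value b T (gb i.+1 j) by rewrite /has_value (ready_y R) /=.
have := ready_adj R; rewrite -/y /adj.
case hr: (has_value b T (right y)); case hb: (has_value b T (below y)) => /=; last first.
- by case/orP => /eqP e; move: hy; rewrite e ?hr ?hb.
- by case/orP => /eqP e; move: hy; rewrite e ?hr ?hb.
- by case/orP => /eqP e; move: hy; rewrite e ?hr ?hb.
have [||jr le_jr [lt_jr er Tr]] := ready_b R hr; rewrite ?leqnSn //.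
have [||jb le_jb [lt_jb eb Tb]] := ready_b R hb; rewrite ?leqnSn //.
have Gb := growth_b G (ready_i R); have V := valley_b G Vb (ready_i R).
have ne : jr != jb.
  by apply/eqP => e; move: er; rewrite e -eb /right /below; case: (y) => r c [] /=; lia.
rewrite /has_prime Tr /=; case: ifP => [lt_jrk|ge_jrk].
  have lt_rb : jr < jb.
    rewrite ltn_neqAle ne leqNgt; apply/negP => lt_br.
    by have := valley_row lt_br (ltnW lt_jrk); rewrite -er -eb /=; lia.
  case/orP => /eqP e; first by rewrite e.
  have := chain_inj Gb (ready_j R) lt_jb; rewrite e -eb => /(_ erefl); lia.
have lt_br : jb < jr.
  rewrite ltn_neqAle eq_sym ne leqNgt; apply/negP => lt_rb.
  have le_k : kb i.+1 <= jr by rewrite leqNgt ge_jrk.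
  by have := valley_col V le_k lt_rb lt_jb; rewrite -er -eb /=; lia.
case/orP => /eqP e; last by rewrite e.
have := chain_inj Gb (ready_j R) lt_jr; rewrite e -er => /(_ erefl); lia.
Qed.

Lemma weight_le lev : (forall l, l < p -> lev l <= q) -> weight lev <= weight (fun=> q).
Proof.
move=> le_q; apply: leq_sum => l _.
by have [] := ga_mono G (ltn_ord l) (le_q l (ltn_ord l)) (leqnn q); lia.
Qed.

Lemma iter_step_good n T lev bl : good T lev bl ->
  weight (fun=> q) <= n + weight lev ->
  exists lev' bl', good (iter n (switch_step a b) T) lev' bl' /\
    next_box a b (iter n (switch_step a b) T) = None.
Proof.
elim: n T lev bl => [|n IH] T lev bl gd.
  case nx: (next_box a b T) => [x|] le_w; last by exists lev, bl.
  have [lev' [bl' [gd' lt_w]]] := step_good gd nx.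
  by have := weight_le (lev_le (good_state gd')); lia.
rewrite iterSr {2 4}/switch_step; case nx: (next_box a b T) => [x|] le_w.
  have [lev' [bl' [gd' lt_w]]] := step_good gd nx; apply: IH gd' _; lia.
have -> : iter n (switch_step a b) T = T.
  by elim: n {IH le_w} => //= n ->; rewrite /switch_step nx.
by exists lev, bl.
Qed.

Lemma displays_dom T : displays T (fun=> 0) (fun=> p) -> forall l, l < p ->
  ga l q \in domf T.
Proof.
move=> D l lt_lp; rewrite -fndSome.
have Ga := growth_a G (leqnn q).
have : S p q (ga l q) := chain_mem Ga lt_lp (leqnn p).
case/(chain_inv (growth_b G (leqnn p)) (leq0n q) (leqnn q)) => [|[m [_ lt_m ->]]]; last first.
  by rewrite (disp_b D).
case/(chain_inv (growth_a G (leq0n q)) (leq0n p) (leqnn p)) => [S0|[m [_ lt_m ->]]]; last first.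
  by rewrite (disp_a D).
have /negP[] := chain_new Ga lt_lp.
exact: (growth_sub G (leq0n l) (ltnW lt_lp) (leq0n q) (leqnn q) S0).
Qed.

(** The number of steps suffices because every step increases the weight, and the
final weight is a partial sum of the sum that defines the number of steps. *)
Theorem switching_growth T : displays T (fun=> 0) (fun=> p) ->
  displays (switching a b T) (fun=> q) (fun=> 0).
Proof.
move=> D; have gd : good T (fun=> 0) (fun=> p).
  by split=> //; split=> // i j lt_ip _; rewrite lt_ip.
have [|lev [bl [gd1 none]]] := @iter_step_good (\sum_(x : domf T) ((val x).1 + (val x).2)) _ _ _ gd.
  apply: leq_trans (leq_addr _ _).
  pose g (l : 'I_p) : domf T := [` displays_dom D (ltn_ord l)]%fset.
  have g_inj : {in [set: 'I_p] &, injective g}.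
    move=> l l' _ _ /(congr1 val) /= e; apply: val_inj.
    exact: (chain_inj (growth_a G (leqnn q)) (ltn_ord l) (ltn_ord l') e).
  have -> : weight (fun=> q) = \sum_(x in g @: [set: 'I_p]) ((val x).1 + (val x).2).
    by rewrite (big_imset _ g_inj) /=; apply: eq_bigl => l; rewrite inE.
  by rewrite big_mkcond; apply: leq_sum => x _; case: ifP.
rewrite -/(switching a b T) in gd1 none.
have [|lev1 [bl1 [[st1 D1 _] full _ _]]] := good_normalize gd1 (leq0n p).
  by move=> l _ _; exact: next_box_none.
have bl0 j : j < q -> bl1 j = 0.
  move=> lt_jq; case: (posnP p) => [e|p_gt0]; first by have := bl_le st1 lt_jq; lia.
  by apply/eqP; rewrite -leqn0 leqNgt -(lev_bl st1) // full //; lia.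
split=> [l lt_lp|j lt_jq|x /(disp_dom D1)[[l lt_lp ->]|[j lt_jq ->]]].
- by have := disp_a D1 lt_lp; rewrite full.
- by have := disp_b D1 lt_jq; rewrite bl0.
- by left; exists l; rewrite ?full.
- by right; exists j; rewrite ?bl0.
Qed.

End Algorithm.

(** * Tableaux as families of valleys *)

Definition lower (v : nat) (T : filling) (x : box) : bool :=
  if T.[? x] is Some l then l.1 < v else false.

Definition prefix (v : nat) (T : filling) (x : nat -> box) (i : nat) (z : box) : bool :=
  lower v T z || has (fun m => z == x m) (iota 0 i).

(** In a valley, primes exactly on the letters followed by a descent mean both that
the list is in standard order and that the letters are in canonical form. *)
Record standardizes (T : filling) (v p : nat) (x : nat -> box) : Prop := {
  std_chain : chain p (prefix v T x) x;
  std_valley : valley p x;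
  std_letter : forall i, i < p -> T.[? x i] = Some (v, i < descents p x);
  std_onto : forall y, has_value v T y -> exists2 i, i < p & y = x i
}.

Lemma prefixS v T x i z : prefix v T x i.+1 z = (z == x i) || prefix v T x i z.
Proof.
by rewrite /prefix -[i.+1]addn1 iotaD has_cat /= orbF add0n; case: (z == _); rewrite ?orbT ?orbF.
Qed.

Lemma prefixP v T x i z :
  reflect (lower v T z \/ exists2 m, m < i & z = x m) (prefix v T x i z).
Proof.
apply: (iffP orP) => -[?|]; try by left.
  by case/hasP => m; rewrite mem_iota add0n => /andP[_ lt] /eqP->; right; exists m.
by case=> m lt_m ->; right; apply/hasP; exists m; rewrite ?mem_iota.
Qed.

Lemma has_valueE v T (x : box) : has_value v T x -> exists f, T.[? x] = Some (v, f).
Proof. by rewrite /has_value; case: (T.[? x]) => // -[w f] /= /eqP->; exists f. Qed.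

Lemma letter_le_trans : transitive letter_le.
Proof. by move=> [v f] [u e] [w g]; rewrite /letter_le /=; case: e f g => -[] [] //=; lia. Qed.

Lemma in_shape_ideal la : strict_partition la -> ideal (in_shape la).
Proof.
move=> /andP[sla nla]; split=> [r c /andP[] //|r c r' c'].
rewrite /in_shape /= => /andP[le1 lt1] le2 le3 le4; rewrite le4 /=.
apply: leq_ltn_trans le3 (leq_trans lt1 _).
have lt_r' : r' < size la.
  by rewrite ltnNge; apply/negP => ge; move: lt1; rewrite nth_default //; lia.
elim: r' le2 lt_r' {lt1 le1} => [|r' IH]; first by rewrite leqn0 => /eqP->.
rewrite leq_eqVlt => /orP[/eqP->//|le2] lt_r'.
apply: leq_trans (IH le2 (ltnW lt_r')).
by have := sorted_ltn_nth (rev_trans ltn_trans) 0 sla r' r'.+1 (ltnW lt_r') lt_r' (ltnSn r'); lia.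
Qed.

Section FromTableau.

Variables (la : seq nat) (n : nat) (T : filling) (v : nat).
Hypothesis TP : ShST la [::] n T.

Lemma ShST_in (x : box) : (x \in domf T) = in_shape la x.
Proof.
rewrite (ShST_dom TP) /in_shape nth_nil addn0.
by case: (x.1 <= x.2 < _) => //=; lia.
Qed.

Lemma ShST_letter (x : box) : in_shape la x -> exists l, T.[? x] = Some l.
Proof. by rewrite -ShST_in => xT; rewrite (in_fnd xT); eexists. Qed.

Lemma ShST_shape (x : box) l : T.[? x] = Some l -> in_shape la x.
Proof. by rewrite -ShST_in; case: fndP. Qed.

Lemma ShST_le r c r' c' k l : r <= r' -> c <= c' ->
  T.[? (r, c)] = Some k -> T.[? (r', c')] = Some l -> letter_le k l.
Proof.
move=> le1 le2 e1 e2; have [q1 I] := in_shape_ideal (ShST_la TP).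
have le3 := q1 _ _ (ShST_shape e1).
have [m em] : exists m, T.[? (r, c')] = Some m.
  by apply: ShST_letter; apply: I (ShST_shape e2) _ _ _; lia.
exact: letter_le_trans (ShST_row TP le2 e1 em) (ShST_col TP le1 em e2).
Qed.

Let N := size la.
(* The list is sorted by this key; N exceeds all the rows, which puts the primed
   boxes first. *)
Let key (x : box) : nat := if has_prime T x then x.1 else N + x.2.
Let s : seq box := sort (relpre key leq) [seq y <- enum_fset (domf T) | has_value v T y].
Let p := size s.
Let x (i : nat) : box := nth (0, 0) s i.

Let mem_s (y : box) : (y \in s) = has_value v T y.
Proof.
rewrite mem_sort mem_filter; case hv: (has_value v T y) => //=.
by have [f e] := has_valueE hv; rewrite -[_ \in _]fndSome e.
Qed.

Let row_lt (y : box) l : T.[? y] = Some l -> y.1 < N.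
Proof.
move/ShST_shape => /andP[le lt]; rewrite ltnNge; apply/negP => ge.
by move: lt; rewrite nth_default //; lia.
Qed.

Let key_inj : {in s &, forall y z : box, key y = key z -> y = z}.
Proof.
move=> y z; rewrite !mem_s => /has_valueE[f ey] /has_valueE[g ez].
have := row_lt ey; have := row_lt ez; rewrite /key /has_prime ey ez.
case: y z ey ez => r c [r' c'] /= + + lt1 lt2.
case: f g => -[] e1 e2 eq_k; try lia.
  by subst r'; congr pair; apply: (ShST_primed TP e1 e2).
have ec : c = c' by lia.
by subst c'; congr pair; apply: (ShST_unprimed TP e1 e2).
Qed.

Let s_x i : i < p -> has_value v T (x i).
Proof. by move=> lt; rewrite -mem_s mem_nth. Qed.

Let key_lt i j : i < j -> j < p -> key (x i) < key (x j).
Proof.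
move=> lt_ij lt_jp; have lt_ip := ltn_trans lt_ij lt_jp.
rewrite ltn_neqAle; apply/andP; split; last first.
  have tr : transitive (relpre key leq) by move=> ? ? ?; exact: leq_trans.
  have so : sorted (relpre key leq) s by apply: sort_sorted => ? ?; exact: leq_total.
  by have := sorted_ltn_nth tr (0, 0) so i j lt_ip lt_jp lt_ij.
apply/eqP => /key_inj; rewrite !mem_nth // => /(_ isT isT) /eqP.
rewrite nth_uniq // ?sort_uniq ?filter_uniq ?fset_uniq //.
by move/eqP => e; move: lt_ij; rewrite e ltnn.
Qed.

Let key_le i j : i < p -> j < p -> key (x i) <= key (x j) -> i <= j.
Proof.
by move=> lt_ip lt_jp; rewrite leqNgt => nlt; rewrite leqNgt; apply: contra nlt => /key_lt->.
Qed.

Let onto (y : box) : has_value v T y -> exists2 i, i < p & y = x i.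
Proof. by rewrite -mem_s => /(nthP (0, 0))[i lt e]; exists i. Qed.

Let K := find (fun y => ~~ has_prime T y) s.

Let primeE i : i < p -> has_prime T (x i) = (i < K).
Proof.
move=> lt_ip; case: (ltnP i K) => [/(before_find (0, 0))/negbFE//|le_K].
have hs : has (fun y => ~~ has_prime T y) s by rewrite has_find; exact: leq_ltn_trans le_K lt_ip.
have lt_Kp : K < p by rewrite -/K has_find in hs.
have nK := nth_find (0, 0) hs; rewrite -/K -/(x K) in nK.
apply/negP => pi; have : key (x K) <= key (x i).
  by move: le_K; rewrite leq_eqVlt => /orP[/eqP<-//|lt]; apply/ltnW/key_lt.
have [f e] := has_valueE (s_x lt_ip); have := row_lt e.
by rewrite /key pi (negPf nK); lia.
Qed.

Let xE i : i < p -> T.[? x i] = Some (v, i < K).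
Proof.
move=> lt_ip; rewrite -primeE // /has_prime.
by have [f ->] := has_valueE (s_x lt_ip).
Qed.

(** This is where the canonical form is used.  The last primed box is not the first
of its value in the reading word, so an unprimed box lies in a lower row; if the
leftmost unprimed box were not below the last primed one too, there would be two
unprimed letters in one column. *)
Let boundary k : K = k.+1 -> K < p /\ (x k).1 < (x K).1.
Proof.
move=> eK; have lt_kp : k < p by rewrite -eK /K /p find_size.
have xk := xE lt_kp; rewrite eK ltnSn in xk.
have xkT : x k \in domf T by rewrite -fndSome xk.
have nf : ~~ first_in_reading [` xkT]%fset.
  have := ShST_canonical TP => /forallP/(_ [` xkT]%fset); rewrite implybE => /orP[//|].
  by have := in_fnd xkT; rewrite xk => -[<-].
move: nf => /forallPn[y]; rewrite negb_imply negbK => /andP[/eqP ev lt_y].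
have ey : T.[? val y] = Some (v, has_prime T (val y)).
  rewrite /has_prime -Some_fnd; case: (T y) ev => [w f] /= ->.
  by have := in_fnd xkT; rewrite xk => -[<-].
have hy : has_value v T (val y) by rewrite /has_value ey /=.
set z : box := val y in ey hy lt_y; clearbody z; move: z {y ev} ey hy lt_y => y ey hy.
rewrite /reading_lt /= => lt_y.
have [m lt_mp em] := onto hy.
have le_Km : K <= m.
  rewrite leqNgt; apply/negP => lt_mK; move: (ey); rewrite {1}em xE // lt_mK => -[pr].
  case/orP: lt_y => [lt_r|/andP[/eqP er lt_c]].
    have : m <= k by lia.
    rewrite leq_eqVlt => /orP[/eqP emk|lt_mk]; first by move: lt_r; rewrite em emk ltnn.
    by have := key_lt lt_mk lt_kp; rewrite /key !primeE // lt_mK eK ltnSn -em; lia.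
  move: ey xk lt_c er; rewrite -pr; case: (y) (x k) => r c [r' c'] /= ey xk lt_c er.
  by subst r'; have := ShST_primed TP ey xk; lia.
have lt_Kp : K < p by exact: leq_ltn_trans le_Km lt_mp.
split=> //; move: (ey); rewrite {1}em xE // ltnNge le_Km /= => -[pr]; rewrite -pr in ey.
have lt_r : (x k).1 < y.1.
  case/orP: lt_y => // /andP[/eqP er lt_c]; move: ey xk lt_c er.
  case: (y) (x k) => r c [r' c'] /= ey xk lt_c er; subst r'.
  by have := ShST_row TP (ltnW lt_c) ey xk; rewrite /letter_le /= ltnn eqxx.
have xK := xE lt_Kp; rewrite ltnn in xK.
have le_c : (x K).2 <= y.2.
  move: le_Km; rewrite leq_eqVlt => /orP[/eqP->|lt_Km]; first by rewrite em.
  have nm : (m < K) = false by lia.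
  by have := key_lt lt_Km lt_mp; rewrite /key !primeE // ltnn nm -em; lia.
rewrite ltnNge; apply/negP => le_r.
case: (x K) y xK ey le_c lt_r le_r {em hy lt_y pr} => r1 c1 [rf cf] /= xK ey le_c lt_r le_r.
have le_rf : r1 <= rf by lia.
have [l el] : exists l, T.[? (r1, cf)] = Some l.
  have [q1 I] := in_shape_ideal (ShST_la TP).
  apply: ShST_letter; apply: I (ShST_shape ey) le_rf (leqnn _) _.
  exact: leq_trans (q1 _ _ (ShST_shape xK)) le_c.
have l1 := ShST_row TP le_c xK el; have l2 := ShST_col TP le_rf el ey.
have e : l = (v, false).
  by case: (l) l1 l2 => w []; rewrite /letter_le /=; case: (ltngtP v w) => // ->.
by rewrite e in el; have := ShST_unprimed TP el ey; lia.
Qed.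

Lemma ShST_standardizes : exists p x, standardizes T v p x.
Proof.
exists p, x.
have C : chain p (prefix v T x) x.
  split=> [i le_ip|i lt_ip z|i lt_ip]; last first.
  - apply/negP => /prefixP[|[m lt_mi e]]; first by rewrite /lower xE //= ltnn.
    by have := key_lt lt_mi lt_ip; rewrite e ltnn.
  - exact: prefixS.
  have [q1 I] := in_shape_ideal (ShST_la TP).
  have sh z : prefix v T x i z -> exists2 l, T.[? z] = Some l & letter_le l (v, false).
    case/prefixP => [|[m lt_mi ->]].
      rewrite /lower; case: (T.[? z]) => // l lt; exists l => //.
      by rewrite /letter_le /= lt.
    have lt_mp := leq_trans lt_mi le_ip; rewrite xE //; eexists; first by [].
    by rewrite /letter_le /= eqxx orbT.
  split=> [r c /sh[l /ShST_shape/q1 //]|r c r' c' Sz le1 le2 le3].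
  have [l el _] := sh _ Sz.
  have [k ek] : exists k, T.[? (r, c)] = Some k.
    by apply: ShST_letter; apply: I (ShST_shape el) le1 le2 le3.
  have le_kl := ShST_le le1 le2 ek el.
  apply/prefixP; move/prefixP: Sz => [|[m lt_mi em]].
    by rewrite /lower el ek => lt; left; move: le_kl; rewrite /letter_le; lia.
  have lt_mp := leq_trans lt_mi le_ip; move: el; rewrite em xE // => -[el].
  case: (ltnP k.1 v) => [lt|ge]; first by left; rewrite /lower ek.
  have kv : k.1 = v by move: le_kl; rewrite -el /letter_le /=; lia.
  have hk : has_value v T (r, c) by rewrite /has_value ek kv /=.
  right; have [m' lt_mp' em'] := onto hk; exists m' => //.
  apply: leq_ltn_trans lt_mi; apply: key_le => //; rewrite -em' -em /key.
  have -> : has_prime T (r, c) = k.2 by rewrite /has_prime ek.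
  have -> : has_prime T (r', c') = l.2 by rewrite em /has_prime xE // -el.
  have := row_lt ek; move: le_kl; rewrite /letter_le -el kv /= ltnn eqxx /=.
  by case: (m < K); case: k.2 => //=; lia.
have [|||V d] := @valley_intro p _ _ K C.
- case E: K => [//|k]; have [lt _] := boundary E; rewrite -E; lia.
- move=> i lt_iK; move: (lt_iK); rewrite leq_eqVlt => /orP[/eqP e|lt_i].
    by have [_] := boundary (esym e); rewrite e.
  have lt_ip : i.+1 < p by apply: leq_trans lt_i _; rewrite /K /p find_size.
  by have := key_lt (ltnSn i) lt_ip; rewrite /key !primeE ?lt_i ?lt_iK // ltnW.
- move=> i le_Ki lt_ip; have := key_lt (ltnSn i) lt_ip.
  by rewrite /key !primeE ?(ltnW lt_ip) // !ltnNge le_Ki (leqW le_Ki) /=; lia.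
by split=> // i lt_ip; rewrite d xE.
Qed.

End FromTableau.

Lemma has_valueP v T (x : box) f : T.[? x] = Some (v, f) -> has_value v T x.
Proof. by rewrite /has_value => -> /=. Qed.

Lemma canonize_id T : canonical T -> canonize T = T.
Proof.
move=> /forallP canT; apply/fmapP => z; case: (boolP (z \in domf T)) => [zT|nzT]; last first.
  by rewrite !not_fnd.
rewrite (in_fnd (f := canonize T) zT) ffunE (in_fnd zT).
have := canT [` zT]%fset; case: (T _) => v f /=.
by case: first_in_reading => /= [/negPf->|_]; rewrite ?andbF ?andbT.
Qed.

(** Comparability of boxes gives the order of the values, since the boxes with
smaller values form an ideal, and within one value the order of the list.  A primed
box is followed by a box in a lower row, which precedes it in the reading word. *)
Lemma standardizes_ShST (la : seq nat) n T : strict_partition la ->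
  (forall x : box, (x \in domf T) = in_shape la x) ->
  (forall (x : box) l, T.[? x] = Some l -> 1 <= l.1 <= n) ->
  (forall v, exists p x, standardizes T v p x) -> ShST la [::] n T.
Proof.
move=> laP domT alph std.
have low r c r' c' k l : r <= r' -> c <= c' -> T.[? (r, c)] = Some k ->
    T.[? (r', c')] = Some l -> letter_le k l.
  move=> le1 le2 ek el.
  have le3 : r <= c by have := domT (r, c); rewrite -fndSome ek => /esym/andP[].
  have [p [x [C V L O]]] := std l.1.
  have [i lt_ip ei] : exists2 i, i < p & (r', c') = x i.
    by apply: O; apply: (@has_valueP _ _ _ l.2); rewrite el; case: (l).
  have Si := chain_mem C (ltnSn i) lt_ip; rewrite -ei in Si.
  have := (chain_ideal C lt_ip).2 _ _ _ _ Si le1 le2 le3.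
  case/prefixP => [|[m lt_m em]]; first by rewrite /lower ek /letter_le => ->.
  have lt_mp : m < p by lia.
  have := L m lt_mp; rewrite -em ek => -[->].
  have := L i lt_ip; rewrite -ei el => -[->]; rewrite /letter_le /= eqxx ltnn /=.
  by apply/implyP => lt_i; lia.
have find_std v : exists p x, [/\ chain p (prefix v T x) x, valley p x &
   forall (y : box) f, T.[? y] = Some (v, f) ->
     exists i, [/\ i < p, y = x i & f = (i < descents p x)]].
  have [p [x [C V L O]]] := std v; exists p, x; split=> // y f ey.
  have [i lt_ip ei] := O _ (has_valueP ey); exists i; split=> //.
  by have := L i lt_ip; rewrite -ei ey => -[->].
split=> //.
- by move=> [r c] /andP[/= le lt]; move: lt; rewrite nth_nil; lia.
- move=> [r c]; rewrite domT [X in _ && ~~ X]/in_shape nth_nil addn0.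
  by case: in_shape => //=; lia.
- by move=> r c c' k l le; apply: low.
- by move=> r r' c k l le; apply: low.
- move=> r r' c v e1 e2; have [p [x [C V H]]] := find_std v.
  have [i [lt_i ei fi]] := H _ _ e1; have [j [lt_j ej fj]] := H _ _ e2.
  have le_i : descents p x <= i by rewrite leqNgt -fi.
  have le_j : descents p x <= j by rewrite leqNgt -fj.
  case: (ltngtP i j) => [lt|lt|e].
  + by have := valley_col V le_i lt lt_j; rewrite -ei -ej /= ltnn.
  + by have := valley_col V le_j lt lt_i; rewrite -ei -ej /= ltnn.
  + by move: ei; rewrite e -ej => -[].
- move=> r c c' v e1 e2; have [p [x [C V H]]] := find_std v.
  have [i [lt_i ei fi]] := H _ _ e1; have [j [lt_j ej fj]] := H _ _ e2.
  case: (ltngtP i j) => [lt|lt|e].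
  + by have := valley_row lt (ltnW (esym fj)); rewrite -ei -ej /= ltnn.
  + by have := valley_row lt (ltnW (esym fi)); rewrite -ei -ej /= ltnn.
  + by move: ei; rewrite e -ej => -[].
- apply/forallP => y; apply/implyP => /forallP fst; apply/negP => pr.
  have ey : T.[? val y] = Some ((T y).1, true) by rewrite -pr -Some_fnd; case: (T y).
  have [p [x [C V L O]]] := std (T y).1.
  have [i lt_i ei] := O _ (has_valueP ey).
  have lt_id : i < descents p x by have := L i lt_i; rewrite -ei ey => -[<-].
  have lt_i1 : i.+1 < p by have := descents_le p x; lia.
  have zT : x i.+1 \in domf T by rewrite -fndSome L.
  have := fst [` zT]%fset; have := L _ lt_i1; rewrite (in_fnd zT) => -[->] /=.
  by rewrite eqxx /= /reading_lt ei (descents_lt lt_id).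
Qed.

(** * The involutions on tableaux *)

Definition relabel (i : nat) (l : letter) : letter :=
  ([eta id with i |-> i.+1, i.+1 |-> i] l.1, l.2).

Lemma fnd_map (T : filling) (g : letter -> letter) (z : box) :
  [fmap x : domf T => g (T x)].[? z] = omap g T.[? z].
Proof.
case: (boolP (z \in domf T)) => [zT|nzT]; last by rewrite !not_fnd.
by rewrite (in_fnd (f := [fmap x : domf T => g (T x)]) zT) ffunE (in_fnd zT).
Qed.

Definition in_pair (i : nat) (T : filling) (z : box) : bool :=
  has_value i T z || has_value i.+1 T z.

Definition pair_part (i : nat) (T : filling) : filling := (part i T + part i.+1 T)%fset.

Lemma fnd_part v T (z : box) : (part v T).[? z] = if has_value v T z then T.[? z] else None.
Proof. by rewrite /part fnd_filterf. Qed.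

Lemma dom_part v T (z : box) : (z \in domf (part v T)) = has_value v T z.
Proof.
rewrite -fndSome fnd_part /has_value.
by case: (T.[? z]) => [l|//]; case: (l.1 == v).
Qed.

Lemma fnd_pair_part i T (z : box) :
  (pair_part i T).[? z] = if in_pair i T z then T.[? z] else None.
Proof.
rewrite /pair_part fnd_cat dom_part !fnd_part /in_pair orbC.
by case: has_value.
Qed.

Lemma fnd_SP i T (z : box) : let U := switching i i.+1 (pair_part i T) in
  (SP i T).[? z] = if in_pair i U z then U.[? z] else T.[? z].
Proof.
move=> U; rewrite /SP /SP1 /SP2 -/(pair_part i T) -/U.
rewrite fnd_cat mem_catf !dom_part fnd_cat dom_part !fnd_part /in_pair.
by case: (has_value i U z); case: (has_value i.+1 U z).
Qed.

(** The result of t_i before canonization; it turns out to be canonical. *)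
Definition raw_BK i T : filling := [fmap x : domf (SP i T) => relabel i (SP i T x)].

Lemma BK_raw i T : BK i T = canonize (raw_BK i T).
Proof. by []. Qed.

Lemma fnd_raw_BK i T (z : box) : let U := switching i i.+1 (pair_part i T) in
  (raw_BK i T).[? z] = omap (relabel i) (if in_pair i U z then U.[? z] else T.[? z]).
Proof. by rewrite /= /raw_BK fnd_map fnd_SP. Qed.

Lemma chain_ext p S S' x : chain p S x -> (forall i z, i <= p -> S' i z = S i z) ->
  chain p S' x.
Proof.
move=> C e; split=> [i le_i|i lt_i z|i lt_i].
- have [I1 I2] := chain_ideal C le_i.
  by split=> [r c|r c r' c']; rewrite !e //; [exact: I1|exact: I2].
- by rewrite !e ?(ltnW lt_i) // (chain_step C).
- by rewrite e ?(ltnW lt_i) // (chain_new C).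
Qed.

Lemma chain_prefixE p S x v T : chain p S x -> S 0 =1 lower v T ->
  forall i z, i <= p -> prefix v T x i z = S i z.
Proof.
move=> C e i z; elim: i => [|i IH] lt_ip; first by rewrite /prefix /= orbF e.
by rewrite prefixS (chain_step C) // IH // ltnW.
Qed.

(** The letters of values i and i + 1 in T are the initial data of the diagram. *)
Record two_letter (i : nat) T (p q : nat) (S : nat -> nat -> pred box)
    (ga gb : nat -> nat -> box) : Prop := {
  tl_growth : growth p q S ga gb;
  tl_va : valley p (ga^~ 0);
  tl_vb : valley q (gb p);
  tl_low : S 0 0 =1 lower i T;
  tl_a : forall l, l < p -> T.[? ga l 0] = Some (i, l < descents p (ga^~ 0));
  tl_b : forall j, j < q -> T.[? gb p j] = Some (i.+1, j < descents q (gb p));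
  tl_onto_a : forall z, has_value i T z -> exists2 l, l < p & z = ga l 0;
  tl_onto_b : forall z, has_value i.+1 T z -> exists2 j, j < q & z = gb p j
}.

Lemma two_letter_exists la n T i : ShST la [::] n T ->
  exists p q S ga gb, two_letter i T p q S ga gb.
Proof.
move=> TP; have [p [xa [Ca Va La Oa]]] := ShST_standardizes i TP.
have [q [xb [Cb Vb Lb Ob]]] := ShST_standardizes i.+1 TP.
have SAB : prefix i T xa p =1 prefix i.+1 T xb 0.
  move=> z; rewrite {2}/prefix /= orbF; apply/prefixP/idP => [[|[m lt_m ->]]|].
  - by rewrite /lower; case: (T.[? z]) => // l; exact: leqW.
  - by rewrite /lower La //= ltnSn.
  rewrite /lower; case e: (T.[? z]) => [[v f]|//] /=; rewrite ltnS leq_eqVlt.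
  case/orP => [/eqP ev|->]; [right|by left].
  by apply: Oa; rewrite -ev; exact: has_valueP e.
have [S [ga [gb [G ea eb e0]]]] := growth_exists Ca Cb SAB.
exists p, q, S, ga, gb; split; rewrite ?ea ?eb //.
- by move=> z; rewrite e0 /prefix /= orbF.
- by move=> l lt_l; rewrite -La // -ea.
- by move=> z /Oa[l lt_l ->]; exists l; rewrite // -ea.
Qed.

Section TwoLetter.

Variables (i p q : nat) (T : filling) (S : nat -> nat -> pred box).
Variables (ga gb : nat -> nat -> box).
Hypothesis TL : two_letter i T p q S ga gb.
Let G := tl_growth TL.

Lemma lower_value v w (z : box) : has_value v T z -> w <= v -> lower w T z = false.
Proof.
by rewrite /has_value /lower; case: (T.[? z]) => // l /eqP->; lia.
Qed.

(** The right-hand side is invariant under transposition, so t_i preserves the set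
of boxes with values i and i + 1. *)
Lemma two_letter_in_pair z : in_pair i T z = S p q z && ~~ S 0 0 z.
Proof.
apply/idP/andP => [|[Sz nSz]].
  rewrite (tl_low TL); case/orP => hv; rewrite (lower_value hv) //; split=> //.
    have [l lt_l ->] := tl_onto_a TL hv.
    have := chain_mem (growth_a G (leq0n q)) lt_l (leqnn p).
    exact: (growth_sub G (leqnn p) (leqnn p) (leq0n q) (leqnn q)).
  have [j lt_j ->] := tl_onto_b TL hv.
  exact: (chain_mem (growth_b G (leqnn p)) lt_j (leqnn q)).
have [|[m [_ lt_m ->]]] := chain_inv (growth_b G (leqnn p)) (leq0n q) (leqnn q) Sz; last first.
  by rewrite /in_pair (has_valueP (tl_b TL lt_m)) orbT.
case/(chain_inv (growth_a G (leq0n q)) (leq0n p) (leqnn p)) => [S0|[m [_ lt_m ->]]].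
  by rewrite S0 in nSz.
by rewrite /in_pair (has_valueP (tl_a TL lt_m)).
Qed.

Let U := switching i i.+1 (pair_part i T).

Lemma two_letter_switching : displays i i.+1 p q ga gb U (fun=> q) (fun=> 0).
Proof.
have ne : i != i.+1 by lia.
apply: (switching_growth ne G (tl_va TL) (tl_vb TL)).
have Ma l : l < p -> in_pair i T (ga l 0).
  by move=> lt; rewrite /in_pair (has_valueP (tl_a TL lt)).
have Mb j : j < q -> in_pair i T (gb p j).
  by move=> lt; rewrite /in_pair (has_valueP (tl_b TL lt)) orbT.
split=> [l lt_l|j lt_j|z].
- by rewrite fnd_pair_part Ma // (tl_a TL).
- by rewrite fnd_pair_part Mb // (tl_b TL).
rewrite -fndSome fnd_pair_part; case: ifP => // /orP[] hv _.
  by left; apply: (tl_onto_a TL hv).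
by right; apply: (tl_onto_b TL hv).
Qed.

Let D := two_letter_switching.

Lemma switching_in_pair z : in_pair i U z = in_pair i T z.
Proof.
rewrite two_letter_in_pair; apply/idP/andP => [mv|[Sz nSz]].
  have zU : z \in domf U.
    by rewrite -fndSome; move: mv; rewrite /in_pair /has_value; case: (U.[? z]).
  case: (disp_dom D zU) => [[l lt_l ->]|[j lt_j ->]]; split.
  - exact: (chain_mem (growth_a G (leqnn q)) lt_l (leqnn p)).
  - apply: contra (chain_new (growth_a G (leqnn q)) lt_l).
    exact: (growth_sub G (leq0n l) (ltnW lt_l) (leq0n q) (leqnn q)).
  - have := chain_mem (growth_b G (leq0n p)) lt_j (leqnn q).
    exact: (growth_sub G (leq0n p) (leqnn p) (leqnn q) (leqnn q)).
  - apply: contra (chain_new (growth_b G (leq0n p)) lt_j).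
    exact: (growth_sub G (leqnn 0) (leq0n p) (leq0n j) (ltnW lt_j)).
have [|[m [_ lt_m ->]]] := chain_inv (growth_a G (leqnn q)) (leq0n p) (leqnn p) Sz; last first.
  by rewrite /in_pair (has_valueP (disp_a D lt_m)).
case/(chain_inv (growth_b G (leq0n p)) (leq0n q) (leqnn q)) => [S0|[m [_ lt_m ->]]].
  by rewrite S0 in nSz.
by rewrite /in_pair (has_valueP (disp_b D lt_m)) orbT.
Qed.

Let V := raw_BK i T.

Lemma fnd_raw z : V.[? z] = if in_pair i T z then omap (relabel i) U.[? z] else T.[? z].
Proof.
rewrite /V fnd_raw_BK -/U switching_in_pair; case: ifP => // nM.
case e: (T.[? z]) => [[v f]|//]; rewrite /relabel /=.
move: nM; rewrite /in_pair /has_value e /=.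
by case: (v == i) => //=; case: (v == i.+1).
Qed.

Lemma raw_a l : l < p -> V.[? ga l q] = Some (i.+1, l < descents p (ga^~ q)).
Proof.
move=> lt_l; have e := disp_a D lt_l; rewrite fnd_raw -switching_in_pair.
by rewrite /in_pair (has_valueP e) e /relabel /= eqxx.
Qed.

Lemma raw_b j : j < q -> V.[? gb 0 j] = Some (i, j < descents q (gb 0)).
Proof.
move=> lt_j; have e := disp_b D lt_j; rewrite fnd_raw -switching_in_pair.
rewrite /in_pair (has_valueP e) e orbT /relabel /= eqxx.
by have -> : (i.+1 == i) = false by lia.
Qed.

Lemma raw_inv z : in_pair i T z -> (exists2 l, l < p & z = ga l q) \/ (exists2 j, j < q & z = gb 0 j).
Proof.
rewrite -switching_in_pair => mv; apply: (disp_dom D).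
by rewrite -fndSome; move: mv; rewrite /in_pair /has_value; case: (U.[? z]).
Qed.

Lemma raw_value v z : v != i -> v != i.+1 -> has_value v V z = has_value v T z.
Proof.
move=> ne1 ne2; case mv: (in_pair i T z); last by rewrite /has_value fnd_raw mv.
have -> : has_value v T z = false.
  move: mv; rewrite /in_pair /has_value; case: (T.[? z]) => // l.
  by case/orP => /eqP->; rewrite eq_sym; apply/negbTE.
case: (raw_inv mv) => [[l lt_l ->]|[j lt_j ->]].
  by rewrite /has_value raw_a //= eq_sym; apply/negbTE.
by rewrite /has_value raw_b //= eq_sym; apply/negbTE.
Qed.

Lemma raw_lower v z : v != i.+1 -> lower v V z = lower v T z.
Proof.
move=> ne; case mv: (in_pair i T z); last by rewrite /lower fnd_raw mv.
have -> : lower v T z = (i < v).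
  move: mv; rewrite /in_pair /has_value /lower; case: (T.[? z]) => // l.
  by case/orP => /eqP->; lia.
case: (raw_inv mv) => [[l lt_l ->]|[j lt_j ->]].
  by rewrite /lower raw_a //=; lia.
by rewrite /lower raw_b.
Qed.

Lemma raw_dom z : (z \in domf V) = (z \in domf T).
Proof.
case mv: (in_pair i T z); last by rewrite -!fndSome fnd_raw mv.
have -> : z \in domf T.
  by rewrite -fndSome; move: mv; rewrite /in_pair /has_value; case: (T.[? z]).
rewrite -fndSome; case: (raw_inv mv) => [[l lt_l ->]|[j lt_j ->]].
  by rewrite raw_a.
by rewrite raw_b.
Qed.

Lemma raw_onto_b z : has_value i V z -> exists2 j, j < q & z = gb 0 j.
Proof.
case mv: (in_pair i T z); last first.
  by rewrite /has_value fnd_raw mv => hv; move: mv; rewrite /in_pair {1}/has_value hv.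
case: (raw_inv mv) => // -[l lt_l ->]; rewrite /has_value raw_a //=; lia.
Qed.

Lemma raw_onto_a z : has_value i.+1 V z -> exists2 l, l < p & z = ga l q.
Proof.
case mv: (in_pair i T z); last first.
  by rewrite /has_value fnd_raw mv => hv; move: mv; rewrite /in_pair [X in _ || X]/has_value hv orbT.
case: (raw_inv mv) => // -[j lt_j ->]; rewrite /has_value raw_b //=; lia.
Qed.

(** The final data of the diagram are the initial data of its transpose. *)
Lemma raw_two_letter :
  two_letter i V q p (fun j i => S i j) (fun j i => gb i j) (fun j i => ga i j).
Proof.
split.
- exact: growth_tr.
- exact: (valley_b G (tl_vb TL) (leq0n p)).
- exact: (valley_a G (tl_va TL) (leqnn q)).
- by move=> z; rewrite (tl_low TL) raw_lower //; lia.
- exact: raw_b.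
- exact: raw_a.
- exact: raw_onto_b.
- exact: raw_onto_a.
Qed.

Lemma raw_standardizes la n v : ShST la [::] n T -> exists p x, standardizes V v p x.
Proof.
move=> TP; have PT := raw_two_letter.
have Va := valley_a G (tl_va TL) (leqnn q).
have Vb := valley_b G (tl_vb TL) (leq0n p).
case: (v =P i) => [->|/eqP ne1].
  have C := growth_b G (leq0n p).
  exists q, (gb 0); split=> //; [|exact: raw_b|exact: raw_onto_b].
  apply: (chain_ext C); apply: (chain_prefixE C).
  exact: tl_low PT.
case: (v =P i.+1) => [->|/eqP ne2].
  have C := growth_a G (leqnn q).
  exists p, (ga^~ q); split=> //; [|exact: raw_a|exact: raw_onto_a].
  apply: (chain_ext C); apply: (chain_prefixE C) => z.
  apply/idP/idP => [|].
    case/(chain_inv (growth_b G (leq0n p)) (leq0n q) (leqnn q)) => [|[m [_ lt_m ->]]].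
      by rewrite (tl_low PT) /lower; case: (V.[? z]) => // l; exact: leqW.
    by rewrite /lower raw_b //= ltnSn.
  rewrite /lower; case e: (V.[? z]) => [[w f]|//] /=; rewrite ltnS leq_eqVlt.
  case/orP => [/eqP ew|lt].
    have [j lt_j ->] : exists2 j, j < q & z = gb 0 j.
      by apply: raw_onto_b; rewrite -ew; exact: has_valueP e.
    exact: (chain_mem (growth_b G (leq0n p)) lt_j (leqnn q)).
  apply: (growth_sub G (leqnn 0) (leq0n p) (leq0n q) (leqnn q)).
  by rewrite (tl_low PT) /lower e.
have [p' [x [C W L O]]] := ShST_standardizes v TP; exists p', x.
have nM l : l < p' -> in_pair i T (x l) = false.
  by move=> lt; rewrite /in_pair /has_value L //= (negPf ne1) (negPf ne2).
split=> //.
- apply: (chain_ext C) => l z le_l; rewrite /prefix raw_lower //.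
- by move=> l lt_l; rewrite fnd_raw nM // L.
- by move=> z; rewrite raw_value //; exact: O.
Qed.

Lemma raw_ShST la n : 0 < i -> ShST la [::] n T -> ShST la [::] (maxn n i.+1) V.
Proof.
move=> i_gt0 TP; apply: standardizes_ShST.
- exact: ShST_la TP.
- by move=> z; rewrite raw_dom (ShST_in TP).
- move=> z l; case mv: (in_pair i T z).
    case: (raw_inv mv) => [[m lt_m ->]|[j lt_j ->]].
      by rewrite raw_a // => -[<-] /=; lia.
    by rewrite raw_b // => -[<-] /=; lia.
  by rewrite fnd_raw mv => /(ShST_alphabet TP); lia.
- by move=> v; apply: raw_standardizes TP.
Qed.

End TwoLetter.

Lemma BK_ShST la n T i : 0 < i -> ShST la [::] n T ->
  [/\ ShST la [::] (maxn n i.+1) (BK i T) & BK i T = raw_BK i T].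
Proof.
move=> i_gt0 TP; have [p [q [S [ga [gb TL]]]]] := two_letter_exists i TP.
have VP := raw_ShST TL i_gt0 TP.
by rewrite BK_raw canonize_id //; exact: ShST_canonical VP.
Qed.

Lemma BK_straight T i : 0 < i -> straight_tableau T -> straight_tableau (BK i T).
Proof.
by move=> i_gt0 [la [n /(BK_ShST i_gt0)[]]]; exists la, (maxn n i.+1).
Qed.

(** Both applications of t_i are computed by one diagram and its transpose, so the
lists of the second result are those of T. *)
Lemma BK_involutive T i : 0 < i -> straight_tableau T -> BK i (BK i T) = T.
Proof.
move=> i_gt0 [la [n TP]]; have [VP eV] := BK_ShST i_gt0 TP.
have [WP eW] := BK_ShST i_gt0 VP.
have [p [q [S [ga [gb TL]]]]] := two_letter_exists i TP.
have TL1 := raw_two_letter TL; have TL2 := raw_two_letter TL1.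
rewrite eW eV; apply/fmapP => z.
have eM : in_pair i (raw_BK i T) z = in_pair i T z.
  by rewrite (two_letter_in_pair TL) (two_letter_in_pair TL1).
case mv: (in_pair i T z); last by rewrite (fnd_raw TL1) eM mv (fnd_raw TL) mv.
case/orP: mv => [/(tl_onto_a TL)[l lt_l ->]|/(tl_onto_b TL)[j lt_j ->]].
  by rewrite (tl_a TL2) // (tl_a TL).
by rewrite (tl_b TL2) // (tl_b TL).
Qed.

Lemma BK_fnd T i (z : box) : 0 < i -> straight_tableau T ->
  (BK i T).[? z] = if in_pair i T z
    then omap (relabel i) (switching i i.+1 (pair_part i T)).[? z] else T.[? z].
Proof.
move=> i_gt0 [la [n TP]]; have [VP ->] := BK_ShST i_gt0 TP.
have [p [q [S [ga [gb TL]]]]] := two_letter_exists i TP.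
exact: fnd_raw TL z.
Qed.

Lemma BK_value T i v (z : box) : 0 < i -> straight_tableau T -> v != i -> v != i.+1 ->
  has_value v (BK i T) z = has_value v T z.
Proof.
move=> i_gt0 [la [n TP]]; have [VP ->] := BK_ShST i_gt0 TP.
have [p [q [S [ga [gb TL]]]]] := two_letter_exists i TP.
exact: raw_value TL _ _.
Qed.

Lemma BK_commute T i j : 0 < i -> i.+1 < j -> straight_tableau T ->
  BK i (BK j T) = BK j (BK i T).
Proof.
move=> i_gt0 lt_ij TP; have j_gt0 : 0 < j by lia.
have mv_far k l (z : box) : 0 < k -> 0 < l -> (k.+1 < l) || (l.+1 < k) ->
    in_pair k (BK l T) z = in_pair k T z.
  by move=> k_gt0 l_gt0 far; rewrite /in_pair !BK_value //; lia.
have excl k l (z : box) : (k.+1 < l) || (l.+1 < k) -> in_pair k T z -> in_pair l T z = false.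
  move=> far; rewrite /in_pair /has_value; case: (T.[? z]) => // m.
  by case/orP => /eqP->; lia.
have part_far k l : 0 < k -> 0 < l -> (k.+1 < l) || (l.+1 < k) ->
    pair_part k (BK l T) = pair_part k T.
  move=> k_gt0 l_gt0 far; apply/fmapP => z.
  rewrite fnd_pair_part.
  rewrite fnd_pair_part.
  rewrite (mv_far _ _ _ k_gt0 l_gt0 far).
  case: ifP => [/(excl _ _ _ far) mv|_]; last by [].
  by rewrite (BK_fnd _ l_gt0 TP) mv.
have far : (i.+1 < j) || (j.+1 < i) by rewrite lt_ij.
have far' : (j.+1 < i) || (i.+1 < j) by rewrite lt_ij orbT.
apply/fmapP => z; rewrite (BK_fnd _ i_gt0 (BK_straight j_gt0 TP)).
rewrite (BK_fnd _ j_gt0 (BK_straight i_gt0 TP)).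
rewrite (mv_far _ _ _ i_gt0 j_gt0 far) (mv_far _ _ _ j_gt0 i_gt0 far').
rewrite (part_far _ _ i_gt0 j_gt0 far) (part_far _ _ j_gt0 i_gt0 far').
rewrite (BK_fnd _ j_gt0 TP) (BK_fnd _ i_gt0 TP).
case mi: (in_pair i T z); last by [].
by rewrite (excl i j z far mi).
Qed.

(** * Relations in the group *)

Definition pos_word (ks : seq nat) : word := [seq (k, false) | k <- ks].

Lemma acts_pos_word ks T T' : straight_tableau T ->
  acts (pos_word ks) T T' <-> T' = foldr (fun k => BK k.+1) T ks.
Proof.
move=> TP; have st ks' : straight_tableau (foldr (fun k => BK k.+1) T ks').
  by elim: ks' => //= k ks' IH; exact: BK_straight.
elim: ks T' => [|k ks IH] T' /=; first by split.
split=> [[T1 [_ /IH-> ->]]|->] //.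
by exists (foldr (fun k => BK k.+1) T ks); split=> //; apply/IH.
Qed.

Local Open Scope group_scope.

Lemma sbk_one ks : (forall T, straight_tableau T -> foldr (fun k => BK k.+1) T ks = T) ->
  sbk_class (pos_word ks) = 1.
Proof.
move=> e; apply/sbk_classP/sbk_trivial => T T' TP _.
by rewrite acts_pos_word // e //; split=> ->.
Qed.

Lemma sbk_mul u v : sbk_class u * sbk_class v = sbk_class (u ++ v).
Proof. exact: SBK_mulE. Qed.

Lemma t_sq i : t_ i * t_ i = 1.
Proof.
rewrite /t_ sbk_mul; apply: (@sbk_one [:: i.-1; i.-1]) => T TP.
exact: BK_involutive.
Qed.

Lemma t_inv i : (t_ i)^-1 = t_ i.
Proof. by apply: (mulgI (t_ i)); rewrite mulgV t_sq. Qed.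

Lemma t_comm i j : (0 < i)%N -> (i.+1 < j)%N -> t_ i * t_ j = t_ j * t_ i.
Proof.
move=> i_gt0 lt_ij.
have : t_ i * t_ j * (t_ i * t_ j) = 1.
  rewrite /t_ !sbk_mul; apply: (@sbk_one [:: i.-1; j.-1; i.-1; j.-1]) => T TP /=.
  have ei : i.-1.+1 = i by lia.
  have ej : j.-1.+1 = j by lia.
  have j_gt0 : (0 < j)%N by lia.
  rewrite ei ej (BK_commute i_gt0 lt_ij TP) BK_involutive ?BK_involutive //.
  exact: BK_straight.
move=> e; apply: (mulgI (t_ i * t_ j)); rewrite e.
by rewrite mulgA -(mulgA (t_ i) (t_ j) (t_ j)) t_sq mulg1 t_sq.
Qed.

Section TwistWords.

Variables (G : groupType) (t : nat -> G).
Hypothesis t_sq : forall i, t i * t i = 1.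
Hypothesis t_comm : forall i j, (0 < i)%N -> (i.+1 < j)%N -> t i * t j = t j * t i.

(** [run] and [twist] are the words p_i and q_i over arbitrary generators. *)
Fixpoint run (i : nat) : G := if i is j.+1 then t i * run j else 1.
Fixpoint twist (i : nat) : G := if i is j.+1 then twist j * run i else 1.

Lemma sq1_inv (x : G) : x * x = 1 -> x^-1 = x.
Proof. by move=> xx; apply: (mulgI x); rewrite mulgV xx. Qed.

Let t_inv i : (t i)^-1 = t i := sq1_inv (t_sq i).

Lemma run_comm k j : (k.+1 < j)%N -> run k * t j = t j * run k.
Proof.
elim: k => [|k IH] lt_kj; first by rewrite mul1g mulg1.
rewrite /= -mulgA IH; last exact: ltnW.
by rewrite !mulgA t_comm.
Qed.

Lemma twist_comm k j : (k.+1 < j)%N -> twist k * t j = t j * twist k.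
Proof.
elim: k => [|k IH] lt_kj; first by rewrite mul1g mulg1.
have -> : twist k.+1 = twist k * run k.+1 by [].
by rewrite -mulgA run_comm // mulgA IH ?mulgA //; exact: ltnW.
Qed.

Lemma twist_flip k : twist k * run k.+1 = (run k.+1)^-1 * twist k.
Proof.
elim: k => [|k IH]; first by rewrite /= mul1g !mulg1 t_inv.
have -> : twist k.+1 = twist k * run k.+1 by [].
rewrite {1}IH; have -> : run k.+2 = t k.+2 * run k.+1 by [].
rewrite (invgM (t k.+2)) t_inv -!mulgA; congr (_ * _).
by rewrite !mulgA twist_comm.
Qed.

Lemma twist_sq k : twist k * twist k = 1.
Proof.
elim: k => [|k IH]; first by rewrite /= mul1g.
have e : twist k.+1 = twist k * run k.+1 by [].
by rewrite {1}e twist_flip e mulgA -(mulgA _ (twist k) (twist k)) IH mulg1 mulVg.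
Qed.

Lemma run_conj k : (0 < k)%N ->
  (run k.+1)^-1 * t 1 * run k.+1 = t 1 * t 2 * t 1 * t 2 * t 1.
Proof.
elim: k => // -[|k] IH _; first by rewrite /= mulg1 invgM !t_inv !mulgA.
rewrite -IH //; have -> : run k.+3 = t k.+3 * run k.+2 by [].
rewrite (invgM (t k.+3)) t_inv -!mulgA; congr (_ * _).
by rewrite [t 1 * _]mulgA t_comm // !mulgA t_sq mul1g.
Qed.

Lemma twist_product i : (0 < i)%N ->
  twist i * t 1 * twist i * (twist i.+1 * t 1 * twist i.+1) =
  ((t 1 * t 2) ^+ 2) ^ (twist i * t 1 * run i.+1 * t 1)^-1.
Proof.
move=> i_gt0; have eq : twist i.+1 = twist i * run i.+1 by [].
move: (run_conj i_gt0) (twist_flip i) eq; move: (run i.+1) => r rc fl eq.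
have e : r * (t 2 * t 1 * t 2 * t 1) * r^-1 * t 1 = r * t 1 * r^-1.
  have -> : t 2 * t 1 * t 2 * t 1 = t 1 * (r^-1 * t 1 * r).
    by rewrite rc !mulgA t_sq mul1g.
  by rewrite !mulgA mulgK -(mulgA _ (t 1) (t 1)) t_sq mulg1.
rewrite {2}eq fl eq !mulgA -(mulgA _ (twist i) (twist i)) twist_sq mulg1.
rewrite conjgE invgK !invgM !t_inv (sq1_inv (twist_sq i)) expgS expg1.
move/(congr1 (fun x => twist i * t 1 * x * twist i)): e; rewrite !mulgA => <-.
by rewrite -(mulgA _ (t 1) (t 1)) t_sq mulg1.
Qed.

Lemma twist_power i k : (0 < i)%N ->
  (twist i * t 1 * twist i * (twist i.+1 * t 1 * twist i.+1)) ^+ k =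
  twist i * t 1 * run i.+1 * t 1 * (t 1 * t 2) ^+ (2 * k)
    * t 1 * (run i.+1)^-1 * t 1 * twist i.
Proof.
move=> i_gt0; rewrite twist_product // -conjXg -expgnA conjgE invgK mulgA.
by rewrite !invgM !t_inv (sq1_inv (twist_sq i)) !mulgA.
Qed.

End TwistWords.

Lemma p_run i : p_ i = run t_ i.
Proof. by elim: i => //= i ->. Qed.

Lemma q_twist i : q_ i = twist t_ i.
Proof. by elim: i => //= i ->; rewrite p_run. Qed.

Theorem proposition4p22 (n i m : nat) (i_ge1 : (1 <= i)%N)
    (i_le : (i <= n - 2)%N) (m_gt0 : (0 < m)%N) :
  ((sigma i * sigma i.+1) ^+ m =
     q_ i * t_ 1 * p_ i.+1 * t_ 1 * (t_ 1 * t_ 2) ^+ (2 * m)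
     * t_ 1 * (p_ i.+1)^-1 * t_ 1 * q_ i)%g
  /\ ((sigma i * sigma i.+1) ^+ 3 =
     q_ i * t_ 1 * p_ i.+1 * t_ 1 * (t_ 1 * t_ 2) ^+ 6
     * t_ 1 * (p_ i.+1)^-1 * t_ 1 * q_ i)%g.
Proof.
have pow := twist_power t_sq t_comm _ i_ge1.
by rewrite /sigma !q_twist !p_run; split; exact: pow.
Qed.
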